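(* Let $\lambda$ be a shape and $X\subseteq\mathrm{Seg}(\lambda)$. Then $X$ is a face of the nonfriendly complex $\Gamma^{NF}(\lambda)$ if and only if there exists $F\in\mathrm{GT}(\lambda)$ such that $F=\bigvee_{s\in X}f(s)$ is the canonical join-representation of $F$ in the Grid-Tamari lattice $\mathrm{GT}(\lambda)$, where $f(s)=\eta(A_s)$.
   Context: A shape is a finite vertex-induced subgraph $\lambda$ of the square grid $\mathbb{Z}^2$ (two points are adjacent iff they differ by 1 in exactly one coordinate and agree in the other). $(a,b)$ is immediately South of $(a,b+1)$ and immediately East of $(a-1,b)$; North and West are the reverse relations. A vertex of $\lambda$ is interior if all four of its grid neighbors are in $\lambda$, and a boundary vertex otherwise. A (boundary) path is a sequence of vertices $(v_0,\ldots,v_l)$ of $\lambda$, $l>0$, with $v_0,v_l$ boundary vertices, $v_1,\dots,v_{l-1}$ interior vertices, and each $v_i$ immediately South or East of $v_{i-1}$. A segment is a sequence of interior vertices $(v_0,\ldots,v_l)$, $l\ge 0$, with each $v_i$ immediately South or East of $v_{i-1}$; $\mathrm{Seg}(\lambda)$ is the set of segments. If $t=(v_i,\dots,v_j)$ is a contiguous subsequence of a path or segment $p=(v_0,\dots,v_l)$, then $p$ starts with $t$ if $i=0$ and otherwise enters $t$ from the West (resp. North) if $v_{i-1}$ is immediately West (resp. North) of $v_i$; $p$ ends with $t$ if $j=l$ and otherwise leaves $t$ to the East (resp. South) if $v_{j+1}$ is immediately East (resp. South) of $v_j$. For a segment $s$, $A_s$ (the SW-subsegments of $s$) is the set of subsegments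 $t\subseteq s$ such that $s$ starts with $t$ or enters $t$ from the North, and $s$ ends with $t$ or leaves $t$ to the East. Two segments $s,t$ are friendly along a common subsegment $u$ if, up to exchanging $s$ and $t$: $s$ starts with $u$ or enters $u$ from the West, and $s$ ends with $u$ or leaves $u$ to the South; and $t$ starts with $u$ or enters $u$ from the North, and $t$ ends with $u$ or leaves $u$ to the East. $\Gamma^{NF}(\lambda)$ is the simplicial complex of sets of segments (including $\emptyset$) whose distinct members are pairwise not friendly along any segment. Two paths $p,q$ kiss along a common segment $s$ if (up to exchanging) $p$ enters $s$ from the West and leaves to the South, while $q$ enters $s$ from the North and leaves to the East. The reduced nonkissing complex $\widetilde\Delta^{NK}(\lambda)$ has as faces the sets of pairwise nonkissing paths that are neither horizontal (only East steps) nor vertical (only South steps). It is known to be pure and thin (each codimension-1 face lies in exactly two facets), and if $F,F'$ are facets with $F\setminus\{p\}=F'\setminus\{q\}$, $p\ne q$, then $p,q$ kiss along a unique segment $s$. Write $F\xrightarrow{s}F'$ (a flip) if here $p$ enters $s$ from the West and leaves to the South and $q$ enters $s$ from the North and leaves to the East. The Grid-Tamari order $\mathrm{GT}(\lambda)$ is the poset on facets of $\widetilde\Delta^{NK}(\lambda)$ with $F\le F'$ iff $F'$ is obtained from $F$ by a (possibly empty) sequence of flips; it is known to be a congruence-uniform (in particular semidistributive) lattice whose Hasse diagram is the graph of flips. A set of segments is biclosed if it and its complement in $\mathrm{Seg}(\lambda)$ are both closed under concatenation ($s\circ t$, defined when the first vertex of $t$ is immediately South or East of the last vertex of $s$). For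 a biclosed set $X$ (each $A_s$ is biclosed), $\eta(X)\in\mathrm{GT}(\lambda)$ is the facet obtained from $\{p_e:\ e\text{ a vertical edge of }\lambda\}$ by removing the vertical paths, where $p_e=(v_0,\ldots,v_l)$ is the unique path with $e=(v_{j-1},v_j)$ for some $j$ such that: for $1\le i\le j-1$, $v_{i-1}$ is North of $v_i$ if $(v_i,\ldots,v_{j-1})\in X$ and West of $v_i$ otherwise; and for $j\le k<l$, $v_{k+1}$ is East of $v_k$ if $(v_j,\ldots,v_k)\in X$ and South of $v_k$ otherwise. In a finite lattice, a join-representation $x=\bigvee A$ is irredundant if $\bigvee B<x$ for every proper subset $B\subsetneq A$. Irredundant join-representations of $x$ are ordered by $A\le B$ iff for every $a\in A$ there is $b\in B$ with $a\le b$; the minimum one, if it exists, is the canonical join-representation of $x$. *)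

(* Defs.v *)
From mathcomp Require Import all_boot all_order all_algebra finmap.
From mathcomp Require Import boolp classical_sets.
From Stdlib Require Import Relation_Operators.

Set Implicit Arguments.
Unset Strict Implicit.
Unset Printing Implicit Defensive.

Import GRing.Theory.
Local Open Scope classical_set_scope.
Local Open Scope ring_scope.

Definition vertex : Type := (int * int)%type.

Definition north (v : vertex) : vertex := (v.1, v.2 + 1).
Definition south (v : vertex) : vertex := (v.1, v.2 - 1).
Definition east (v : vertex) : vertex := (v.1 + 1, v.2).
Definition west (v : vertex) : vertex := (v.1 - 1, v.2).

(* A vertex-induced subgraph of the grid is determined by its vertex set. *)
Definition grid_shape : Type := {fset (int * int)}.

Definition interior (lambda : grid_shape) (v : vertex) : bool :=
  [&& v \in lambda, north v \in lambda, south v \in lambda,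
      east v \in lambda & west v \in lambda].

Definition boundary (lambda : grid_shape) (v : vertex) : bool :=
  (v \in lambda) && ~~ interior lambda v.

Definition south_step : rel vertex := fun v w => w == south v.
Definition east_step : rel vertex := fun v w => w == east v.
Definition se_step : rel vertex := fun v w => south_step v w || east_step v w.

(* [behead (belast v0 p')] is (v_1, ..., v_(l-1)) when p = (v_0, ..., v_l). *)
Definition is_bpath (lambda : grid_shape) (p : seq vertex) : bool :=
  if p is v0 :: p' then
    [&& p' != [::], path se_step v0 p',
        boundary lambda v0, boundary lambda (last v0 p')
      & all (interior lambda) (behead (belast v0 p'))]
  else false.

Definition is_segment (lambda : grid_shape) (s : seq vertex) : bool :=
  [&& s != [::], sorted se_step s & all (interior lambda) s].

Definition Seg (lambda : grid_shape) : set (seq vertex) :=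
  [set s | is_segment lambda s].

Definition horizontal (p : seq vertex) : bool := sorted east_step p.
Definition vertical (p : seq vertex) : bool := sorted south_step p.

(* Position of a nonempty contiguous subsequence t in a path or segment p.
   As p is strictly monotone its vertices are distinct, so t occurs in p at
   most once and the conditions below all speak about the same occurrence. *)
Definition starts_with (p t : seq vertex) : bool := prefix t p.
Definition ends_with (p t : seq vertex) : bool := suffix t p.
Definition enters_west (p t : seq vertex) : bool :=
  if t is v :: _ then infix (west v :: t) p else false.
Definition enters_north (p t : seq vertex) : bool :=
  if t is v :: _ then infix (north v :: t) p else false.
Definition leaves_east (p t : seq vertex) : bool :=
  if t is v :: t' then infix (rcons t (east (last v t'))) p else false.
Definition leaves_south (p t : seq vertex) : bool :=
  if t is v :: t' then infix (rcons t (south (last v t'))) p else false.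

Definition SW_subsegments (lambda : grid_shape) (s : seq vertex) :
    set (seq vertex) :=
  [set t | [&& is_segment lambda t, infix t s,
               starts_with s t || enters_north s t
             & ends_with s t || leaves_east s t]].

Definition friendly_oriented (s t u : seq vertex) : bool :=
  [&& infix u s, infix u t,
      starts_with s u || enters_west s u, ends_with s u || leaves_south s u,
      starts_with t u || enters_north t u & ends_with t u || leaves_east t u].

Definition friendly (lambda : grid_shape) (s t : seq vertex) : Prop :=
  exists2 u, is_segment lambda u
           & friendly_oriented s t u || friendly_oriented t s u.

Definition nonfriendly_complex (lambda : grid_shape) : set (set (seq vertex)) :=
  [set X | X `<=` Seg lambda
         /\ forall s t, X s -> X t -> s <> t -> ~ friendly lambda s t].

Definition kiss_oriented (p q s : seq vertex) : bool :=
  [&& enters_west p s, leaves_south p s, enters_north q s & leaves_east q s].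

Definition kiss (lambda : grid_shape) (p q : seq vertex) : Prop :=
  exists2 s, is_segment lambda s & kiss_oriented p q s || kiss_oriented q p s.

Definition nonkissing_complex (lambda : grid_shape) : set (set (seq vertex)) :=
  [set F | (forall p, F p ->
              [&& is_bpath lambda p, ~~ horizontal p & ~~ vertical p])
         /\ forall p q, F p -> F q -> ~ kiss lambda p q].

(* The ground set of the Grid-Tamari order. *)
Definition GT (lambda : grid_shape) : set (set (seq vertex)) :=
  [set F | nonkissing_complex lambda F
         /\ forall G, nonkissing_complex lambda G -> F `<=` G -> G = F].

Definition flip (lambda : grid_shape) (s : seq vertex) (F F' : set (seq vertex)) :
    Prop :=
  [/\ GT lambda F, GT lambda F', is_segment lambda s
    & exists p q, [/\ F p, F' q, p <> q, F `\ p = F' `\ q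
                    & kiss_oriented p q s]].

Definition GT_le (lambda : grid_shape) (F F' : set (seq vertex)) : Prop :=
  clos_refl_trans (set (seq vertex))
    (fun G G' => exists s, flip lambda s G G') F F'.

(* (v_i, ..., v_k) for p = (v_0, ..., v_l) *)
Definition slice (p : seq vertex) (i k : nat) : seq vertex :=
  take (k.+1 - i) (drop i p).

(* p is the path p_e of the vertical edge e = (u, south u). *)
Definition is_edge_path (lambda : grid_shape) (X : set (seq vertex)) (u : vertex)
    (p : seq vertex) : Prop :=
  let v := nth (0, 0) p in
  is_bpath lambda p /\
  exists j : nat,
    [/\ (0 < j < size p)%N, v j.-1 = u, v j = south u,
        forall i : nat, (1 <= i <= j.-1)%N ->
          v i.-1 = if slice p i j.-1 \in X then north (v i) else west (v i)
      & forall k : nat, (j <= k)%N -> (k.+1 < size p)%N ->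
          v k.+1 = if slice p j k \in X then east (v k) else south (v k)].

Definition eta (lambda : grid_shape) (X : set (seq vertex)) : set (seq vertex) :=
  [set p | ~~ vertical p /\
           exists u : vertex, [/\ u \in lambda, south u \in lambda
                                & is_edge_path lambda X u p]].

Definition fseg (lambda : grid_shape) (s : seq vertex) : set (seq vertex) :=
  eta lambda (SW_subsegments lambda s).

(* Joins and join-representations in a poset with ground set L and order le;
   they are relational, so no lattice structure on L is presupposed. *)
Section JoinRepresentations.
Variables (T : Type) (L : set T) (le : T -> T -> Prop).

Definition is_join (A : set T) (x : T) : Prop :=
  [/\ L x, forall a, A a -> le a x
    & forall y, L y -> (forall a, A a -> le a y) -> le x y].

Definition join_rep (A : set T) (x : T) : Prop := A `<=` L /\ is_join A x.

Definition irredundant_join_rep (A : set T) (x : T) : Prop :=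
  join_rep A x /\
  forall B, B `<` A -> exists y, [/\ is_join B y, le y x & y <> x].

Definition join_refines (A B : set T) : Prop :=
  forall a, A a -> exists2 b, B b & le a b.

Definition canonical_join_rep (A : set T) (x : T) : Prop :=
  irredundant_join_rep A x /\
  forall B, irredundant_join_rep B x -> join_refines A B.

End JoinRepresentations.

(* Main.v *)
(* Call a set of segments a torsion class if it is closed under concatenation
   and under SW-subsegments.  For a biclosed set X, eta X is the set of
   nonstraight boundary paths p such that a segment along which p bends lies in X
   exactly when p enters it from the North and leaves to the East: such a path is
   recovered from the unique vertical edge that dominates the other vertical
   edges of p.  Hence eta X is a facet, and a facet F determines a torsion class
   Tof F, the largest one compatible with F; eta and Tof are mutually inverse.

   Adding one segment to a biclosed set changes eta by at most one flip, and any
   inclusion of biclosed sets refines to such steps.  Conversely a flip enlarges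
   Tof: two paths exchanged by a flip cannot kiss in both directions, since both
   kisses would be attached to the distinguished vertical edge of the first path.
   So GT is isomorphic to the poset of torsion classes ordered by inclusion, where
   f(s) is A_s and joins are concatenation closures of unions.

   There, segments behave like bricks, SW-subsegments like quotients and
   NE-subsegments like submodules; s and t are friendly when there is a nonzero
   morphism between them, and the claim becomes the correspondence between
   semibricks and canonical join representations, with Schur's lemma as the key
   step. *)
Require Import Defs.
From mathcomp Require Import all_boot all_order all_algebra finmap.
From mathcomp Require Import boolp classical_sets.
From mathcomp Require Import zify.
From Stdlib Require Import Relation_Operators.

Set Implicit Arguments.
Unset Strict Implicit.
Unset Printing Implicit Defensive.

Local Open Scope classical_set_scope.

(** * Factorizations of words and positions of factors *)

Lemma eq_cat_cases (T : Type) (a b c d : seq T) : a ++ b = c ++ d ->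
  (exists e, c = a ++ e /\ b = e ++ d) \/
  (exists x e, a = c ++ x :: e /\ d = x :: e ++ b).
Proof.
elim: a c => [|x a IH] [|y c] /=.
- by move=> ->; left; exists [::].
- by move=> ->; left; exists (y :: c).
- by move=> <-; right; exists x, a.
case=> -> /IH[[e [-> ->]]|[z [e [-> ->]]]]; first by left; exists e.
by right; exists z, e.
Qed.

Lemma neq_negb (b c : bool) : b <> c -> b = ~~ c.
Proof. by case: b; case: c. Qed.

Lemma neq_negbF (b c : bool) : (b == ~~ c) = false -> b = c.
Proof. by case: b; case: c. Qed.

Lemma infix_cat_cases (T : Type) (P Q a u b : seq T) : P ++ Q = a ++ u ++ b ->
  [\/ exists d, P = a ++ u ++ d /\ b = d ++ Q,
      exists d, Q = d ++ u ++ b /\ a = P ++ d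
    | exists x u1 y u2, [/\ u = (x :: u1) ++ y :: u2, P = a ++ x :: u1
                          & Q = (y :: u2) ++ b]].
Proof.
move=> /eq_cat_cases[[e [-> ->]]|[x [e [->]]]].
  by constructor 2; exists e.
rewrite -cat_cons => /eq_cat_cases[[d [-> ->]]|[y [u2 [-> ->]]]].
  by constructor 1; exists d.
by constructor 3; exists x, e, y, u2.
Qed.

Lemma cat_diverge (T : eqType) (b1 b2 : seq T) :
  [\/ b1 = b2,
      exists x c, b1 = b2 ++ x :: c, exists x c, b2 = b1 ++ x :: c
    | exists c x y r1 r2, [/\ b1 = c ++ x :: r1, b2 = c ++ y :: r2 & x != y]].
Proof.
elim: b1 b2 => [|x b1 IH] [|y b2]; first by constructor 1.
- by constructor 3; exists y, b2.
- by constructor 2; exists x, b1.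
case: (eqVneq x y) => [<-|nxy]; last by constructor 4; exists [::], x, y, b1, b2.
case: (IH b2) => [->|[z [c ->]]|[z [c ->]]|[c [z [t [r1 [r2 [-> -> nzt]]]]]]].
- by constructor 1.
- by constructor 2; exists z, c.
- by constructor 3; exists z, c.
- by constructor 4; exists (x :: c), z, t, r1, r2.
Qed.

(** When no letter repeats, the index of the first letter of [u] is both [size a] and [size a']. *)
Lemma occurrence_uniq (T : eqType) (a u b a' b' : seq T) :
  uniq (a ++ u ++ b) -> u != [::] -> a ++ u ++ b = a' ++ u ++ b' ->
  a = a' /\ b = b'.
Proof.
case: u => // x u Hu _ E.
have E2 : a = a'.
  have na : x \notin a.
    by move: Hu; rewrite cat_uniq => /and3P[_ /hasPn/(_ x)]; rewrite inE eqxx => /(_ isT).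
  have na' : x \notin a'.
    by move: Hu; rewrite E cat_uniq => /and3P[_ /hasPn/(_ x)]; rewrite inE eqxx => /(_ isT).
  have := congr1 (index x) E.
  rewrite !cat_cons !index_cat (negPf na) (negPf na') /= eqxx !addn0.
  by move=> Es; move: E => /eqP; rewrite eqseq_cat // => /andP[/eqP].
split=> //; subst a'; apply/eqP; move/eqP: E.
by rewrite !eqseq_cat // !eqxx => /eqP->.
Qed.

(** * Monotone grid paths and the directions of their steps *)

Definition origin : vertex := (0%R, 0%R).
(** South and East steps both raise this by one, so it is a coordinate along every monotone path. *)
Definition diag (v : vertex) : int := (v.1 - v.2)%R.

Lemma diag_south (v : vertex) : diag (south v) = (diag v + 1)%R.
Proof. by rewrite /diag /south /=; lia. Qed.

Lemma diag_east (v : vertex) : diag (east v) = (diag v + 1)%R.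
Proof. by rewrite /diag /east /=; lia. Qed.

Lemma diag_se_step (v w : vertex) : se_step v w -> diag w = (diag v + 1)%R.
Proof.
by rewrite /se_step => /orP[] /eqP->; [apply: diag_south|apply: diag_east].
Qed.

Lemma se_sorted_diag (p : seq vertex) (i : nat) : sorted se_step p ->
  (i < size p)%N -> diag (nth origin p i) = (diag (head origin p) + i%:Z)%R.
Proof.
move=> Hp; elim: i => [|i IH] Hi; first by rewrite nth0; lia.
move/(sortedP origin): Hp => /(_ _ Hi)/diag_se_step ->; rewrite IH; lia.
Qed.

Lemma se_sorted_diag_inj (p : seq vertex) : sorted se_step p ->
  {in p &, injective diag}.
Proof.
move=> Hp v w /(nthP origin)[i Hi <-] /(nthP origin)[j Hj <-].
by rewrite !se_sorted_diag // => E; congr nth; lia.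
Qed.

Lemma se_sorted_uniq (p : seq vertex) : sorted se_step p -> uniq p.
Proof.
move=> Hp; apply/(uniqP origin) => i j; rewrite !inE => Hi Hj /(congr1 diag).
by rewrite !se_sorted_diag //; lia.
Qed.

Lemma south_neq_east (v : vertex) : (south v == east v) = false.
Proof. by rewrite /east /south -pair_eqE /=; lia. Qed.

Lemma south_north (v : vertex) : south (north v) = v.
Proof. by case: v => x y; rewrite /north /south /=; congr pair; lia. Qed.
Lemma north_south (v : vertex) : north (south v) = v.
Proof. by case: v => x y; rewrite /north /south /=; congr pair; lia. Qed.
Lemma east_west (v : vertex) : east (west v) = v.
Proof. by case: v => x y; rewrite /west /east /=; congr pair; lia. Qed.
Lemma west_east (v : vertex) : west (east v) = v.
Proof. by case: v => x y; rewrite /west /east /=; congr pair; lia. Qed.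

(* The direction (true for East, false for South) of the step joining the
   consecutive nonempty pieces a and b of a path. *)
Definition est (a b : seq vertex) : bool := head origin b == east (last origin a).

Lemma est_catr a u b : u != [::] -> est a (u ++ b) = est a u.
Proof. by case: u. Qed.

Lemma est_catl a u b : u != [::] -> est (a ++ u) b = est u b.
Proof. by case: u => // x u _; rewrite /est last_cat. Qed.

Lemma cat_neq0r (T : eqType) (a b : seq T) : b != [::] -> a ++ b != [::].
Proof. by case: a. Qed.
Lemma cat_neq0l (T : eqType) (a b : seq T) : a != [::] -> a ++ b != [::].
Proof. by case: a. Qed.

Lemma se_sorted_cat a b : a != [::] -> b != [::] ->
  sorted se_step (a ++ b) =
  [&& sorted se_step a, sorted se_step b
    & head origin b == (if est a b then east else south) (last origin a)].
Proof.
case: a => // x a _; case: b => // y b _; rewrite /est /= cat_path /=.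
rewrite [se_step (last x a) y]/se_step /south_step /east_step.
by case E: (y == east _); rewrite ?eqxx ?orbT ?orbF ?andbT /=; do ! case: (path _ _ _) => //=; rewrite ?andbT ?andbF ?E.
Qed.

Lemma se_sorted_catl a b : sorted se_step (a ++ b) -> sorted se_step a.
Proof. by case/cat_sorted2. Qed.
Lemma se_sorted_catr a b : sorted se_step (a ++ b) -> sorted se_step b.
Proof. by case/cat_sorted2. Qed.

Lemma est_head a b : sorted se_step (a ++ b) -> a != [::] -> b != [::] ->
  head origin b = (if est a b then east else south) (last origin a).
Proof. by move=> H Ha Hb; move: H; rewrite se_sorted_cat // => /and3P[_ _ /eqP]. Qed.

Lemma est_last a b : sorted se_step (a ++ b) -> a != [::] -> b != [::] ->
  last origin a = (if est a b then west else north) (head origin b).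
Proof.
move=> H Ha Hb; rewrite (est_head H Ha Hb).
by case: ifP => _; rewrite ?west_east ?north_south.
Qed.

Lemma horizontal_est a b : a != [::] -> b != [::] -> horizontal (a ++ b) ->
  est a b = true.
Proof.
case: a => // x a _; case: b => // y b _.
by rewrite /horizontal /= cat_path /= => /and3P[_ h _].
Qed.

Lemma vertical_est a b : a != [::] -> b != [::] -> vertical (a ++ b) ->
  est a b = false.
Proof.
case: a => // x a _; case: b => // y b _.
rewrite /vertical /= cat_path /= /est => /and3P[_ /eqP /= -> _].
exact: south_neq_east.
Qed.

(** * Entering and leaving, SW- and NE-subsegments, bends *)

Definition ent (d : bool) (p u : seq vertex) : bool :=
  if d then enters_north p u else enters_west p u.
Definition lev (d : bool) (p u : seq vertex) : bool :=
  if d then leaves_east p u else leaves_south p u.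

Section Occurrence.
Variables (p a u b : seq vertex).
Hypotheses (Hp : sorted se_step p) (Ep : p = a ++ u ++ b) (Hu : u != [::]).

Let uq a' b' : p = a' ++ u ++ b' -> a = a' /\ b = b'.
Proof.
move=> E; apply: (@occurrence_uniq _ _ u) => //; last by rewrite -Ep.
by rewrite -Ep; apply: se_sorted_uniq.
Qed.

Lemma starts_withP : starts_with p u = (a == [::]).
Proof.
apply/prefixP/eqP => [[b' E]|a0]; first by case: (@uq [::] b' E).
by exists b; rewrite Ep a0.
Qed.

Lemma ends_withP : ends_with p u = (b == [::]).
Proof.
apply/suffixP/eqP => [[a' E]|b0]; last by exists a; rewrite Ep b0 cats0.
by case: (@uq a' [::]) => //; rewrite cats0.
Qed.

Lemma entP d : ent d p u = (a != [::]) && (est a u == ~~ d).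
Proof.
have -> : ent d p u = infix ((if d then north else west) (head origin u) :: u) p.
  by rewrite /ent; case: d; case: (u) Hu.
apply/infixP/andP => [[a' [b' E]]|[Ha /eqP Hd]].
  have Ea : a = rcons a' ((if d then north else west) (head origin u)).
    by case: (@uq (rcons a' ((if d then north else west) (head origin u))) b') => //; rewrite cat_rcons.
  rewrite Ea /est last_rcons; split; first by case: (a').
  by case: (d); rewrite ?east_west ?eqxx // -{1}(south_north (head origin u)) south_neq_east.
case/lastP: a Ha Hd Ep => // a' x _ Hd E; exists a', b; rewrite E cat_rcons.
have : sorted se_step (rcons a' x ++ u).
  by move: Hp; rewrite E catA => /se_sorted_catl.
move/est_last; rewrite Hd last_rcons => -> //; last by case: (a').
by case: (d).

Qed.

Lemma levP d : lev d p u = (b != [::]) && (est u b == d).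
Proof.
have -> : lev d p u = infix (rcons u ((if d then east else south) (last origin u))) p.
  by rewrite /lev; case: d; case: (u) Hu.
apply/infixP/andP => [[a' [b' E]]|[Hb /eqP Hd]].
  have Eb : b = (if d then east else south) (last origin u) :: b'.
    by case: (@uq a' ((if d then east else south) (last origin u) :: b')) => //;
       rewrite E cat_rcons.
  rewrite Eb /est /=; split => //.
  by case: (d); rewrite ?eqxx ?south_neq_east.
case: b Hb Hd Ep => // y b' _ Hd E; exists a, b'; rewrite E cat_rcons.
have : sorted se_step (u ++ y :: b').
  by move: Hp; rewrite E => /se_sorted_catr.
by move/est_head => /(_ Hu isT) /= ->; rewrite Hd.
Qed.

End Occurrence.

(* [part true s t]: t is an SW-subsegment of s, that is, t is in A_s; in
   [part false s t] the compass is mirrored (t is a NE-subsegment). *)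
Definition part (d : bool) (s t : seq vertex) : Prop :=
  exists a b : seq vertex, [/\ s = a ++ t ++ b, t != [::],
    a != [::] -> est a t = ~~ d & b != [::] -> est t b = d].

(* [bends p false u]: p enters u from the West and leaves to the South;
   [bends p true u]: p enters u from the North and leaves to the East. *)
Definition bends (p : seq vertex) (d : bool) (u : seq vertex) : Prop :=
  exists a b : seq vertex, [/\ p = a ++ u ++ b, [&& a != [::], u != [::] & b != [::]],
    est a u = ~~ d & est u b = d].

Lemma part_refl d s : s != [::] -> part d s s.
Proof. by exists [::], [::]; rewrite cats0. Qed.

Lemma part_neq0 d s t : part d s t -> t != [::].
Proof. by case=> a [b []]. Qed.

Lemma part_trans d s t u : part d s t -> part d t u -> part d s u.
Proof.
move=> [a [b [-> tn Ha Hb]]] [c [e [Et un Hc He]]].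
exists (a ++ c), (e ++ b); subst t; split=> //; first by rewrite -!catA.
- case: (eqVneq c [::]) Ha Hc => [-> |cn Ha Hc _]; last by rewrite est_catl // Hc.
  by rewrite cats0 /= est_catr // => Ha _; apply: Ha.
- case: (eqVneq e [::]) Hb He => [-> |en Hb He _]; last by rewrite est_catr // He.
  rewrite cats0 /= => Hb _; case: (eqVneq c [::]) Hb => [->//|cn].
  by rewrite est_catl.
Qed.

Lemma part_size d s t : part d s t -> t = s \/ (size t < size s)%N.
Proof.
case=> a [b [-> tn _ _]]; rewrite !size_cat.
case: a => [|x a]; last by right; rewrite /=; lia.
case: b => [|y b]; first by left; rewrite cats0.
by right; rewrite /=; lia.
Qed.

Lemma part_anti d s t : part d s t -> part d t s -> s = t.
Proof. by move=> /part_size[//|h] /part_size[//|]; lia. Qed.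

Section Shape.
Variable lambda : grid_shape.
Local Notation segment := (is_segment lambda).

Lemma segment_sorted s : segment s -> sorted se_step s.
Proof. by case/and3P. Qed.
Lemma segment_neq0 s : segment s -> s != [::].
Proof. by case/and3P. Qed.

Lemma segment_catl a b : segment (a ++ b) -> a != [::] -> segment a.
Proof.
case/and3P => _ /se_sorted_catl h; rewrite all_cat => /andP[ha _] an.
exact/and3P.
Qed.

Lemma segment_catr a b : segment (a ++ b) -> b != [::] -> segment b.
Proof.
case/and3P => _ /se_sorted_catr h; rewrite all_cat => /andP[_ ha] an.
exact/and3P.
Qed.

Lemma segment_part d s t : segment s -> part d s t -> segment t.
Proof.
move=> Hs [a [b [E tn _ _]]]; move: Hs; rewrite E => /segment_catr.
by rewrite (cat_neq0l _ tn) => /(_ isT)/segment_catl/(_ tn).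
Qed.

Lemma partP d s t : sorted se_step s -> t != [::] ->
  part d s t <-> [/\ infix t s, starts_with s t || ent d s t & ends_with s t || lev d s t].
Proof.
move=> Hs tn; split=> [[a [b [E _ Ha Hb]]]|[/infixP[a [b E]]]].
  rewrite (starts_withP Hs E tn) (ends_withP Hs E tn) (entP Hs E tn) (levP Hs E tn).
  split; first by rewrite E infix_infix.
  - by case: eqP Ha => //= _ ->.
  - by case: eqP Hb => //= _ ->.
rewrite (starts_withP Hs E tn) (ends_withP Hs E tn) (entP Hs E tn) (levP Hs E tn).
move=> Ha Hb; exists a, b; split => //.
- by move=> an; move: Ha; rewrite (negPf an) => /eqP.
- by move=> bn; move: Hb; rewrite (negPf bn) => /eqP.
Qed.

Lemma SW_subsegmentsP s t : segment s ->
  SW_subsegments lambda s t <-> part true s t.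
Proof.
move=> Hs; split=> [/and4P[Ht *]|H].
  by apply/partP => //; [apply: segment_sorted | apply: segment_neq0].
have Ht := segment_part Hs H.
by case/(partP _ (segment_sorted Hs) (segment_neq0 Ht)): H => *; apply/and4P.
Qed.

Lemma friendly_orientedP s t u : segment s -> segment t -> segment u ->
  friendly_oriented s t u <-> part false s u /\ part true t u.
Proof.
move=> /segment_sorted Hs /segment_sorted Ht /segment_neq0 Hu; split.
  by case/and5P=> ? ? ? ? /andP[? ?]; split; apply/partP.
move=> [/(partP _ Hs Hu)[? ? ?] /(partP _ Ht Hu)[? ? ?]].
by apply/and5P; split=> //; apply/andP.
Qed.

Lemma bendsP p d u : sorted se_step p -> u != [::] ->
  bends p d u <-> ent d p u && lev d p u.
Proof.
move=> Hp un; split.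
  move=> [a [b [E /and3P[an _ bn] Ha Hb]]].
  by rewrite (entP Hp E un) (levP Hp E un) an bn Ha Hb !eqxx.
case/andP => He Hl.
have /infixP[a [b E]] : infix u p.
  by case: (u) He => [|x u']; case: (d) => //= /consl_infix.
move: He Hl; rewrite (entP Hp E un) (levP Hp E un).
move=> /andP[an /eqP Ha] /andP[bn /eqP Hb].
by exists a, b; split => //; apply/and3P.
Qed.

Lemma bends_at p d u a b : sorted se_step p -> bends p d u -> p = a ++ u ++ b ->
  [/\ a != [::], b != [::], est a u = ~~ d & est u b = d].
Proof.
move=> Hp [a' [b' [E /and3P[an un bn] Ha Hb]]] E2.
have [<- <-] // : a' = a /\ b' = b.
by apply: (@occurrence_uniq _ a' u b'); rewrite -?E //; apply: se_sorted_uniq.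
Qed.

Lemma bends_part p d u : bends p d u -> part d p u.
Proof. by move=> [a [b [-> /and3P[? ? ?] ? ?]]]; exists a, b. Qed.

Lemma bends_neq0 p d u : bends p d u -> u != [::].
Proof. by move/bends_part/part_neq0. Qed.

(** At an end shared by [t] and [u] the step is that of [p] around [u]; at any other end it is a
    step inside [u], governed by [part d u t]. *)
Lemma part_bends p d u t : bends p d u -> part d u t -> bends p d t.
Proof.
move=> [a [b [-> /and3P[an un bn] Ha Hb]]] [c [e [E tn Hc He]]]; subst u.
exists (a ++ c), (e ++ b); split; first by rewrite -!catA.
- by rewrite tn cat_neq0l // cat_neq0r.
- case: (eqVneq c [::]) Ha Hc => [-> |cn Ha Hc]; last by rewrite est_catl // Hc.
  by rewrite cats0 /= est_catr.
- case: (eqVneq e [::]) Hb He => [-> |en Hb He]; last by rewrite est_catr // He.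
  rewrite cats0 /= => Hb _; case: (eqVneq c [::]) Hb => [->//|cn].
  by rewrite est_catl.
Qed.

Lemma bpathP p : reflect
  (exists x m y, [/\ p = x :: rcons m y, boundary lambda x, boundary lambda y,
     all (interior lambda) m & sorted se_step p]) (is_bpath lambda p).
Proof.
apply: (iffP idP) => [|[x [m [y [-> Hx Hy Hm Hs]]]]]; last first.
  rewrite /is_bpath last_rcons Hx Hy; apply/and5P; split=> //; first by case: (m).
  by rewrite belast_rcons.
case: p => // x p /and5P[]; case/lastP: p => // m y _ Hs Hx.
rewrite last_rcons => Hy; rewrite belast_rcons /= => Hm.
by exists x, m, y.
Qed.

Lemma bpath_sorted p : is_bpath lambda p -> sorted se_step p.
Proof. by case/bpathP=> x [m [y []]]. Qed.

Lemma bpath_segment a u b : is_bpath lambda (a ++ u ++ b) ->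
  a != [::] -> u != [::] -> b != [::] -> segment u.
Proof.
case/bpathP=> x [m [y [E _ _ Hm Hs]]] an un bn.
apply/and3P; split => //; first exact: se_sorted_catl (se_sorted_catr Hs).
case: a an E {Hs} => // z a _ [_]; case/lastP: b bn => // b t _.
rewrite -!rcons_cat => /rcons_inj[E _]; move: Hm; rewrite -E !all_cat.
by case/and3P.
Qed.

Lemma bends_segment p d u : is_bpath lambda p -> bends p d u -> segment u.
Proof. by move=> Hp [a [b [E /and3P[an un bn] _ _]]]; apply: (@bpath_segment a u b); rewrite -?E. Qed.

Lemma kiss_orientedP p q s : sorted se_step p -> sorted se_step q -> s != [::] ->
  kiss_oriented p q s <-> bends p false s /\ bends q true s.
Proof.
move=> Hp Hq sn; rewrite !bendsP // /kiss_oriented /ent /lev.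
by split=> [/and4P[-> -> -> ->]|[/andP[-> ->] /andP[-> ->]]].
Qed.

Lemma kissP p q : is_bpath lambda p -> is_bpath lambda q ->
  kiss lambda p q <-> exists d u, bends p d u /\ bends q (~~ d) u.
Proof.
move=> Hp Hq; have Sp := bpath_sorted Hp; have Sq := bpath_sorted Hq; split.
  move=> [u /segment_neq0 un /orP[] /kiss_orientedP[] // h1 h2].
    by exists false, u.
  by exists true, u.
move=> [d [u [h1 h2]]]; exists u; first exact: bends_segment h1.
have un := bends_neq0 h1; apply/orP.
by case: d h1 h2 => h1 h2; [right|left]; apply/kiss_orientedP.
Qed.

Lemma bends_nonstraight p d u : bends p d u -> ~~ horizontal p && ~~ vertical p.
Proof.
move=> [a [b [-> /and3P[an un bn] Ha Hb]]].
have un' : u ++ b != [::] by apply: cat_neq0l.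
have an' : a ++ u != [::] by apply: cat_neq0l.
apply/andP; split; apply/negP => H.
- have := horizontal_est an un' H; rewrite est_catr // Ha => dF.
  by move: H; rewrite catA => /(horizontal_est an' bn); rewrite est_catl // Hb; case: (d) dF.
- have := vertical_est an un' H; rewrite est_catr // Ha => dF.
  by move: H; rewrite catA => /(vertical_est an' bn); rewrite est_catl // Hb; case: (d) dF.
Qed.

End Shape.

(** * Biclosed sets and compatible paths *)

Section Biclosed.
Variable lambda : grid_shape.
Local Notation segment := (is_segment lambda).
Local Notation bpath := (is_bpath lambda).

Definition biclosed (X : set (seq vertex)) : Prop :=
  [/\ X `<=` Seg lambda,
      forall a b : seq vertex, X a -> X b -> segment (a ++ b) -> X (a ++ b)
    & forall a b, a != [::] -> b != [::] -> X (a ++ b) -> X a \/ X b].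

Definition compat (X : set (seq vertex)) (p : seq vertex) : Prop :=
  forall d u, bends p d u -> (u \in X) = d.

(* P ++ Q is the path p_e of its vertical edge e = (last P, head Q). *)
Definition edge_split (X : set (seq vertex)) (P Q : seq vertex) : Prop :=
  [/\ [&& P != [::], Q != [::] & ~~ est P Q],
      forall a c : seq vertex, P = a ++ c -> a != [::] -> c != [::] -> est a c = (c \notin X)
    & forall c b : seq vertex, Q = c ++ b -> c != [::] -> b != [::] -> est c b = (c \in X)].

(** The boolean [d] treats a biclosed set and its complement together; the next two lemmas solve for
    one piece, given the other piece and the whole. *)
Lemma biclosed_cat X a b d : biclosed X -> segment (a ++ b) ->
  a != [::] -> b != [::] -> (a \in X) = d -> (b \in X) = d -> (a ++ b \in X) = d.
Proof.
move=> [_ cl ccl] Hs an bn; case: d => [/set_mem Ha /set_mem Hb|Ha Hb].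
  by apply/mem_set/cl.
by apply/negP => /set_mem/ccl[] // /mem_set; rewrite ?Ha ?Hb.
Qed.

Lemma biclosed_catl X a b d : biclosed X -> segment (a ++ b) ->
  a != [::] -> b != [::] -> (a ++ b \in X) = d -> (b \in X) = ~~ d -> (a \in X) = d.
Proof.
move=> HX Hs an bn Hab Hb; case Ha: (a \in X); case: d Hab Hb => // Hab Hb.
  by rewrite (biclosed_cat HX Hs an bn Ha Hb) in Hab.
by rewrite (biclosed_cat HX Hs an bn Ha Hb) in Hab.
Qed.

Lemma biclosed_catr X a b d : biclosed X -> segment (a ++ b) ->
  a != [::] -> b != [::] -> (a ++ b \in X) = d -> (a \in X) = ~~ d -> (b \in X) = d.
Proof.
move=> HX Hs an bn Hab Ha; case Hb: (b \in X); case: d Hab Ha => // Hab Ha.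
  by rewrite (biclosed_cat HX Hs an bn Ha Hb) in Hab.
by rewrite (biclosed_cat HX Hs an bn Ha Hb) in Hab.
Qed.

(** If [u] lies in [P], the backward rules place [u ++ c] and the stretch [c] between [u] and the
    edge on opposite sides of [X], and biclosedness then places [u]. The case of [Q] is symmetric;
    if [u] straddles the edge, the rules place its two halves. *)
Lemma edge_split_compat X P Q : biclosed X -> bpath (P ++ Q) ->
  edge_split X P Q -> compat X (P ++ Q).
Proof.
move=> HX Hp [/and3P[Pn Qn _] HP HQ] d u [a [b [E /and3P[an un bn] Ha Hb]]].
have Hu := bends_segment Hp (ex_intro _ a (ex_intro _ b (And4 E (introT and3P (And3 an un bn)) Ha Hb))).
case/infix_cat_cases: (E) => [[c [EP Eb]]|[c [EQ Ea]]|[x [u1 [y [u2 [Eu EP EQ]]]]]].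
- case: (eqVneq c [::]) => [c0|cn].
    by apply: negb_inj; rewrite -Ha (HP a u) // EP c0 cats0.
  have uc : u ++ c != [::] by apply: cat_neq0l.
  have Huc : (u ++ c \in X) = d.
    by apply: negb_inj; rewrite -(HP _ _ EP an uc) est_catr.
  have Hc : (c \in X) = ~~ d.
    apply: negb_inj; rewrite -(HP (a ++ u) c) ?cat_neq0r -?catA // est_catl // negbK.
    by rewrite -Hb Eb est_catr.
  apply: (biclosed_catl HX _ un cn Huc Hc).
  by apply: (@bpath_segment _ a (u ++ c) Q) => //; rewrite -!catA -Eb -E.
- case: (eqVneq c [::]) => [c0|cn].
    by rewrite -(HQ u b) // EQ c0.
  have cu : c ++ u != [::] by apply: cat_neq0l.
  have Hcu : (c ++ u \in X) = d.
    by rewrite -(HQ _ b) // ?EQ ?catA // est_catl.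
  have Hc : (c \in X) = ~~ d.
    rewrite -(HQ c (u ++ b)) ?EQ // ?cat_neq0l // est_catr //.
    by move: Ha; rewrite Ea est_catl.
  apply: (biclosed_catr HX _ cn un Hcu Hc).
  by apply: (@bpath_segment _ P (c ++ u) b) => //; rewrite -!catA -EQ.
- subst u; apply: (biclosed_cat HX) => //.
    by apply: negb_inj; rewrite -(HP _ _ EP an isT) -Ha est_catr.
  by rewrite -(HQ _ _ EQ isT bn); move: Hb; rewrite est_catl.
Qed.

Lemma est_horizontal p : sorted se_step p ->
  (forall a b, p = a ++ b -> a != [::] -> b != [::] -> est a b) -> horizontal p.
Proof.
move=> Hp H; apply/(sortedP origin) => i Hi.
have := H (take i.+1 p) (drop i.+1 p) (esym (cat_take_drop _ _)).
have St : size (take i.+1 p) = i.+1 by rewrite size_takel // ltnW.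
rewrite -!size_eq0 size_drop St /est -nth0 nth_drop addn0 -nth_last St /= nth_take //.
by apply=> //; rewrite -lt0n subn_gt0.
Qed.

(* Among the vertical edges of a compatible path, the last one which beats all
   its predecessors is the edge of the path. *)
Lemma compat_edge_split X p : biclosed X -> bpath p -> ~~ horizontal p ->
  compat X p -> exists P Q, p = P ++ Q /\ edge_split X P Q.
Proof.
move=> HX Hp Hh Hc.
(* Induction on the prefixes [R] of [p]: each one either has East steps only or already has its own
   marked edge. *)
suff H R R' : p = R ++ R' -> R != [::] ->
    (forall a b, R = a ++ b -> a != [::] -> b != [::] -> est a b) \/
    exists P Q, R = P ++ Q /\ edge_split X P Q.
  case: (H p [::]) => //; first by rewrite cats0.
  - by apply: contraNneq Hh => ->.
  - by move/(est_horizontal (bpath_sorted Hp)); rewrite (negPf Hh).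
elim/last_ind: R R' => // R z IH R'; rewrite cat_rcons => Ep _.
case: (eqVneq R [::]) => [->|Rn].
  left=> -[|x a] // [|y b] //.
  by move/(congr1 size); rewrite /= size_cat /=; lia.
case: (IH _ Ep Rn) => [RE|[P [Q [ER [/and3P[Pn Qn nPQ] HP HQ]]]]].
  case zE : (est R [:: z]).
    left=> a b; case/lastP: b => // b y E an _.
    move: E; rewrite -rcons_cat => /rcons_inj[E <-].
    case: (eqVneq b [::]) E => [-> |bn] E; first by rewrite -[a]cats0 -E zE.
    by rewrite -cats1 est_catr //; apply: RE.
  right; exists R, [:: z]; split; first by rewrite cats1.
  split=> //; first by rewrite Rn zE.
    move=> a c E an cn; have aE := RE _ _ E an cn; rewrite aE.
    apply/esym; apply/negbT; apply: (Hc false).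
    exists a, (z :: R'); split=> //; first by rewrite Ep E catA.
      by rewrite an cn.
    by move: zE; rewrite E est_catl // => ->.
  by move=> [|x c] [|y b] // /(congr1 size); rewrite /= size_cat /=; lia.
have Hz : est Q [:: z] = est R [:: z] by rewrite ER est_catl.
have Qb : bends p (est Q [:: z]) Q \/ est Q [:: z] = false.
  case zE : (est Q _); [left|by right].
  by exists P, (z :: R'); rewrite Ep ER -catA Pn Qn (negPf nPQ); split.
case: (boolP (est Q [:: z] == (Q \in X))) => [/eqP QE|QE].
  (* The step to [z] follows the forward rule, so the marked edge stays where it is. *)
  right; exists P, (rcons Q z); split; first by rewrite ER rcons_cat.
  split=> //; first by rewrite Pn -cats1 est_catr // nPQ; case: (Q) Qn.
  move=> c b; case/lastP: b => // b y E cn _.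
  move: E; rewrite -rcons_cat => /rcons_inj[E <-].
  case: (eqVneq b [::]) E => [-> |bn] E; first by rewrite -[c]cats0 -E.
  by rewrite -cats1 est_catr //; apply: HQ.
have QX : Q \in X /\ est Q [:: z] = false.
  by case: Qb QE => [/Hc->|->]; [rewrite eqxx|case: (Q \in X)].
case: QX {Qb QE} => QX QE.
(* Here [Q] is in [X] yet the step to [z] goes South, so this new vertical edge takes over. Its
   backward rule is checked according to the position of the cut relative to the old edge. *)
right; exists R, [:: z]; split; first by rewrite cats1.
split=> //; first by rewrite Rn -Hz QE.
  2: by move=> [|x c] [|y b] // /(congr1 size); rewrite /= size_cat /=; lia.
move=> a c; rewrite ER => /eq_cat_cases[[e [Ea EQ]]|[x [c1 [EP Ec]]]] an cn.
- case: (eqVneq e [::]) Ea EQ => [-> Ea EQ|en Ea EQ].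
    by rewrite Ea cats0 (_ : c = Q) ?QX ?(negPf nPQ) // EQ.
  rewrite Ea est_catl //; case ec: (est e c).
    apply/esym; apply/negbT; apply: (Hc false).
    exists (P ++ e), (z :: R'); split=> //; first by rewrite Ep ER EQ !catA.
    - by rewrite cn cat_neq0l.
    - by rewrite est_catl.
    - by move: QE; rewrite EQ est_catl // => ->.
  apply/esym/negbTE; rewrite negbK.
  have eX : (e \in X) = false by rewrite -(HQ e c).
  apply: (@biclosed_catr X e c true HX) => //; last by rewrite -EQ.
  by rewrite -EQ; apply: (@bpath_segment _ P Q (z :: R')); rewrite // catA -ER -Ep.
- rewrite -cat_cons in Ec.
  have aE : est a c = (x :: c1 \notin X) by rewrite Ec est_catr // (HP _ _ EP an isT).
  rewrite aE.
  have Eb : p = a ++ c ++ z :: R' by rewrite Ep ER EP Ec !catA.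
  have Hs : segment c by apply: (@bpath_segment _ a c (z :: R')); rewrite -?Eb.
  case cX : (x :: c1 \in X).
    by rewrite Ec (biclosed_cat HX _ _ Qn cX QX) // -Ec.
  apply/esym; apply/negbT; apply: (Hc false).
  exists a, (z :: R'); split; rewrite ?an ?cn //.
    by rewrite aE cX.
  by rewrite Ec est_catl.
Qed.

(** The stretch [c] between two distinct marked edges would be outside of [X] by the forward rule of
    the first and inside by the backward rule of the second. *)
Lemma edge_split_uniq X P Q P' Q' : edge_split X P Q -> edge_split X P' Q' ->
  P ++ Q = P' ++ Q' -> P = P'.
Proof.
wlog: P Q P' Q' / (size P <= size P')%N => [H|].
  case: (leqP (size P) (size P')) => [|/ltnW] h h1 h2 E; first exact: (H P Q P' Q').
  by apply/esym/(H P' Q' P Q).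
move=> Hsz [/and3P[Pn Qn nPQ] HP HQ] [/and3P[Pn' Qn' nPQ'] HP' HQ'].
case/eq_cat_cases => [[c [EP EQ]]|[x [c [EP _]]]]; last first.
  by move: Hsz; rewrite EP size_cat /=; lia.
case: (eqVneq c [::]) EP EQ => [-> ->|cn EP EQ]; first by rewrite cats0.
have := HQ _ _ EQ cn Qn'; have := HP' _ _ EP Pn cn.
move: nPQ nPQ'; rewrite EQ est_catr // EP est_catl // => /negbTE-> /negbTE-> /esym.
by move/negbFE->.
Qed.

End Biclosed.

(** * The paths of vertical edges as compatible paths *)

Section Eta.
Variable lambda : grid_shape.
Local Notation segment := (is_segment lambda).
Local Notation bpath := (is_bpath lambda).

Lemma size_neq0 (s : seq vertex) : s != [::] -> (0 < size s)%N.
Proof. by case: s. Qed.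

Lemma nth_cat_head (a b : seq vertex) : b != [::] -> nth origin (a ++ b) (size a) = head origin b.
Proof. by rewrite nth_cat ltnn subnn nth0. Qed.

Lemma nth_cat_last (a b : seq vertex) : a != [::] -> nth origin (a ++ b) (size a).-1 = last origin a.
Proof. by case: a => // x a _; rewrite nth_cat /= ltnSn nth_last. Qed.

Lemma slice_cat (a c b : seq vertex) (k : nat) :
  (k.+1 = size a + size c)%N -> slice (a ++ c ++ b) (size a) k = c.
Proof.
move=> kE; rewrite /slice drop_size_cat // take_size_cat //.
by rewrite kE addKn.
Qed.

Lemma est_lastE (x : bool) a b : sorted se_step (a ++ b) -> a != [::] -> b != [::] ->
  (last origin a = if x then north (head origin b) else west (head origin b)) <-> est a b = ~~ x.
Proof.
move=> H an bn; split=> [E|E].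
  rewrite /est E; case: (x); rewrite ?east_west ?eqxx //.
  by rewrite -{1}(south_north (head origin b)) south_neq_east.
by rewrite (est_last H) // E; case: (x).
Qed.

Lemma est_headE (x : bool) a b : sorted se_step (a ++ b) -> a != [::] -> b != [::] ->
  (head origin b = if x then east (last origin a) else south (last origin a)) <-> est a b = x.
Proof.
move=> H an bn; split=> [E|E].
  by rewrite /est E; case: (x); rewrite ?eqxx ?south_neq_east.
by rewrite (est_head H) // E; case: (x).
Qed.

(** Cutting [p] at the index [j] turns slices into factors: those ending at [j.-1] are suffixes of
    [P], those starting at [j] are prefixes of [Q]. *)
Lemma edge_pathP X p : bpath p ->
  (exists u, [/\ u \in lambda, south u \in lambda & is_edge_path lambda X u p]) <->
  exists P Q, p = P ++ Q /\ edge_split X P Q.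
Proof.
move=> Hp; have Sp := bpath_sorted Hp; split.
  move=> [u [_ _ [_ [j [/andP[j0 jp] Eu Es Hi Hk]]]]].
  have Ep := cat_take_drop j p; have szP : size (take j p) = j by rewrite size_takel // ltnW.
  exists (take j p), (drop j p); split => //.
  move: (take j p) (drop j p) Ep szP => P Q Ep szP; subst j p.
  have Pn : P != [::] by rewrite -size_eq0 -lt0n.
  have Qn : Q != [::] by apply: contraTneq jp => ->; rewrite cats0 ltnn.
  split.
  - rewrite Pn Qn /=; move: Eu Es; rewrite nth_cat_last // nth_cat_head //.
    by rewrite /est => -> ->; rewrite south_neq_east.
  - move=> a c EP an cn; subst P.
    have := Hi (size a); rewrite -catA nth_cat_last // nth_cat_head ?cat_neq0l //.
    rewrite slice_cat; last by rewrite prednK // size_cat.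
    have -> : head origin (c ++ Q) = head origin c by case: (c) cn.
    move=> H; apply/est_lastE => //; first exact: se_sorted_catl Sp.
    apply: H; move: (size_neq0 an) (size_neq0 cn); rewrite size_cat; lia.
  - move=> c b EQ cn bn; subst Q.
    have := Hk (size P + size c).-1.
    have c0 : (0 < size c)%N by apply: size_neq0.
    have b0 : (0 < size b)%N by apply: size_neq0.
    rewrite slice_cat; last by lia.
    rewrite prednK; last by lia.
    rewrite catA -size_cat nth_cat_last ?cat_neq0r // nth_cat_head //.
    rewrite last_cat; have -> : last (last origin P) c = last origin c by case: (c) cn.
    move=> H; apply/est_headE => //; first exact: se_sorted_catr Sp.
    by apply: H; rewrite !size_cat; lia.
move=> [P [Q [Ep [/and3P[Pn Qn nPQ] HP HQ]]]]; subst p.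
have P0 : (0 < size P)%N by apply: size_neq0.
have Q0 : (0 < size Q)%N by apply: size_neq0.
have Hin : all (mem lambda) (P ++ Q).
  case/bpathP: Hp => x [m [y [-> /andP[Hx _] /andP[Hy _] Hm _]]].
  rewrite /= all_rcons /= Hx Hy /=; apply: sub_all Hm => z.
  by case/and5P.
have HQs : head origin Q = south (last origin P) by rewrite (est_head Sp) // (negPf nPQ).
exists (last origin P); split.
- move/allP: Hin; apply; rewrite mem_cat; apply/orP; left.
  by case: (P) Pn => // x s _; apply: (mem_last x s).
- rewrite -HQs; move/allP: Hin; apply; rewrite mem_cat; apply/orP; right.
  by case: (Q) Qn => // x s _; apply: (mem_head x s).
split=> //; exists (size P); split.
- by rewrite size_cat; lia.
- exact: nth_cat_last.
- by rewrite [LHS]nth_cat_head.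
- move=> i /andP[i0 iP]; have iP' : (i < size P)%N by lia.
  move: iP; have Ei := cat_take_drop i P; have szi : size (take i P) = i by rewrite size_takel // ltnW.
  have cn : drop i P != [::] by rewrite -size_eq0 size_drop -lt0n subn_gt0.
  have an : take i P != [::] by rewrite -size_eq0 szi -lt0n.
  move: (take i P) (drop i P) cn an Ei szi => a c cn an Ei szi _.
  rewrite -Ei -szi -catA nth_cat_last // nth_cat_head ?cat_neq0l //.
  rewrite slice_cat; last by rewrite -size_cat Ei prednK.
  have -> : head origin (c ++ Q) = head origin c by case: (c) cn.
  apply/est_lastE => //; first by rewrite Ei; apply: se_sorted_catl Sp.
  by rewrite (HP a c).
- move=> k kP kQ; rewrite size_cat in kQ.
  pose i := (k.+1 - size P)%N; have Ei := cat_take_drop i Q.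
  have iQ : (i < size Q)%N by rewrite /i; lia.
  have szi : size (take i Q) = i by rewrite size_takel // ltnW.
  have bn : drop i Q != [::] by rewrite -size_eq0 size_drop -lt0n subn_gt0.
  have cn : take i Q != [::] by rewrite -size_eq0 szi -lt0n /i; lia.
  move: (take i Q) (drop i Q) cn bn Ei szi => c b cn bn Ei szi.
  have kE : k.+1 = (size P + size c)%N by rewrite szi /i; lia.
  have -> : k = (size (P ++ c)).-1 by rewrite size_cat -kE.
  rewrite prednK ?size_cat -?kE // kE -size_cat -Ei catA nth_cat_last ?cat_neq0r //.
  rewrite nth_cat_head // last_cat; have -> : last (last origin P) c = last origin c by case: (c) cn.
  rewrite -catA slice_cat; last by rewrite size_cat -kE.
  apply/est_headE => //; first by rewrite Ei; apply: se_sorted_catr Sp.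
  by rewrite (HQ c b).
Qed.

(** Membership in [eta X] becomes a condition on all bends of [p], without reference to an edge;
    [compat_edge_split] recovers the edge. *)
Lemma etaP X p : biclosed lambda X ->
  eta lambda X p <-> [/\ bpath p, ~~ horizontal p, ~~ vertical p & compat X p].
Proof.
move=> HX; split=> [[Hv [u [Hu Hs He]]]|[Hp Hh Hv Hc]].
  have Hp : bpath p by case: He.
  have [P [Q [Ep HPQ]]] : exists P Q, p = P ++ Q /\ edge_split X P Q.
    by apply/edge_pathP => //; exists u.
  subst p; split=> //; last exact: (edge_split_compat HX).
  case: HPQ => /and3P[Pn Qn nPQ] _ _.
  by apply: contraNN nPQ => /horizontal_est ->.
split=> //; have [P [Q H]] := compat_edge_split HX Hp Hh Hc.
by have [u [? ? ?]] := (edge_pathP X Hp).2 (ex_intro _ P (ex_intro _ Q H)); exists u.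
Qed.

End Eta.

(** * Rays to the boundary and the maximality of [eta X] *)

Section Rays.
Variable lambda : grid_shape.
Local Notation segment := (is_segment lambda).
Local Notation bpath := (is_bpath lambda).

Definition shape_size : nat := size (enum_fset lambda).

Lemma sorted_size_le s : sorted se_step s -> all (mem lambda) s ->
  (size s <= shape_size)%N.
Proof. by move=> /se_sorted_uniq us /allP Hs; apply: uniq_leq_size. Qed.

Lemma interior_mem v : interior lambda v -> v \in lambda.
Proof. by case/and5P. Qed.

(** [brule] and [frule] are the two halves of [edge_split], governing the walks backward and forward
    from an edge. *)
Definition brule (X : set (seq vertex)) P :=
  forall a c : seq vertex, P = a ++ c -> a != [::] -> c != [::] -> est a c = (c \notin X).
Definition frule (X : set (seq vertex)) Q :=
  forall c b : seq vertex, Q = c ++ b -> c != [::] -> b != [::] -> est c b = (c \in X).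

(** The rule dictates the next vertex from the stretch walked so far. The walk reaches the boundary
    because a monotone walk repeats no vertex, so its length is bounded by [shape_size]. *)
Lemma backward_ray X z c : sorted se_step (z :: c) -> all (interior lambda) c ->
  z \in lambda -> brule X (z :: c) ->
  exists a x P, [/\ a ++ z :: c = x :: P, sorted se_step (x :: P),
    all (interior lambda) P, boundary lambda x & brule X (x :: P)].
Proof.
have [n] := ubnP (shape_size - size c)%N.
elim: n z c => // n IH z c Hn Hs Hc Hz HX.
have [Hi|Hi] := boolP (interior lambda z); last first.
  by exists [::], z, c; rewrite /boundary Hz Hi.
pose w := if z :: c \in X then north z else west z.
have Hsw : sorted se_step (w :: z :: c).
  rewrite /= in Hs *; rewrite Hs andbT /w /se_step /south_step /east_step.
  by case: ifP => _; rewrite ?south_north ?east_west eqxx ?orbT.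
have Hsz : (size (z :: c) <= shape_size)%N.
  apply: sorted_size_le => //=; rewrite Hz; apply: sub_all Hc => v; exact: interior_mem.
have [|||||a [x [P [E H1 H2 H3 H4]]]] := IH w (z :: c).
- by rewrite /= in Hsz *; lia.
- exact: Hsw.
- by rewrite /= Hi.
- by case/and5P: Hi => _ ? _ _ ?; rewrite /w; case: ifP.
(* The cut after [w] obeys the rule by the choice of [w]; all later cuts are cuts of [z :: c]. *)
- move=> [|t [|t' a]] d //= [<-].
    move=> E _ _; rewrite -E /est /w /=; case: ifP => _; last by rewrite east_west eqxx.
    by rewrite -{1}(south_north z) south_neq_east.
  by move=> ez ec _ dn; have := HX (t' :: a) d; rewrite ez ec => <-.
by exists (rcons a w), x, P; rewrite cat_rcons.
Qed.

Lemma forward_ray X c z : sorted se_step (rcons c z) -> all (interior lambda) c ->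
  z \in lambda -> frule X (rcons c z) ->
  exists b Q y, [/\ rcons c z ++ b = rcons Q y, sorted se_step (rcons Q y),
    all (interior lambda) Q, boundary lambda y & frule X (rcons Q y)].
Proof.
have [n] := ubnP (shape_size - size c)%N.
elim: n c z => // n IH c z Hn Hs Hc Hz HX.
have [Hi|Hi] := boolP (interior lambda z); last first.
  by exists [::], c, z; rewrite /boundary Hz Hi cats0.
pose w := if rcons c z \in X then east z else south z.
have rn : rcons c z != [::] by case: (c).
have ew : est (rcons c z) [:: w] = (rcons c z \in X).
  by rewrite /est last_rcons /w /=; case: ifP => _; rewrite ?eqxx ?south_neq_east.
have Hsw : sorted se_step (rcons (rcons c z) w).
  rewrite -(cats1 _ w) se_sorted_cat // Hs /= ew /w last_rcons.
  by case: ifP => _.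
have Hsz : (size (rcons c z) <= shape_size)%N.
  apply: sorted_size_le => //=; rewrite all_rcons /= Hz; apply: sub_all Hc => v; exact: interior_mem.
have [|||||b [Q [y [E H1 H2 H3 H4]]]] := IH (rcons c z) w.
- by rewrite size_rcons in Hsz *; lia.
- exact: Hsw.
- by rewrite all_rcons Hi.
- by case/and5P: Hi => _ _ ? ? _; rewrite /w; case: ifP.
- move=> d b; case/lastP: b => // b t; rewrite -rcons_cat => /rcons_inj[E <-] dn _.
  have [b0|bn] := eqVneq b [::].
    by rewrite b0 cats0 in E; rewrite b0 -E ew.
  by rewrite -cats1 est_catr // (HX d b E).
by exists (w :: b), Q, y; rewrite -cat_rcons.
Qed.

Lemma edge_join X x P Q y : sorted se_step (x :: P) -> sorted se_step (rcons Q y) ->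
  all (interior lambda) P -> all (interior lambda) Q ->
  boundary lambda x -> boundary lambda y ->
  head origin (rcons Q y) = south (last x P) ->
  brule X (x :: P) -> frule X (rcons Q y) ->
  bpath ((x :: P) ++ rcons Q y) /\ edge_split X (x :: P) (rcons Q y).
Proof.
move=> HP HQ iP iQ Hx Hy E bP bQ.
have Qn : rcons Q y != [::] by case: (Q).
have eF : est (x :: P) (rcons Q y) = false by rewrite /est E south_neq_east.
split; last by split; rewrite // Qn eF.
apply/bpathP; exists x, (P ++ Q), y; split => //.
- by rewrite rcons_cat.
- by rewrite all_cat iP.
- by rewrite se_sorted_cat // HP HQ eF E eqxx.
Qed.

(* For such u, the paths of the vertical edges entering the first vertex of u
   and leaving the last one follow u. *)
Definition tight (X : set (seq vertex)) u := forall c1 c2 : seq vertex, u = c1 ++ c2 ->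
  c1 != [::] -> c2 != [::] ->
  (c1 \in X) = est c1 c2 /\ (c2 \in X) = ~~ est c1 c2.

Lemma tight_brule X u : tight X u -> brule X u.
Proof. by move=> H a c E an cn; case: (H _ _ E an cn) => _ ->; rewrite negbK. Qed.

Lemma tight_frule X u : tight X u -> frule X u.
Proof. by move=> H a c E an cn; case: (H _ _ E an cn) => ->. Qed.

(** For [u] in [X] the path is that of the vertical edge arriving at the first vertex of [u],
    otherwise that of the vertical edge departing from the last one. One ray runs along [u] by
    tightness, and the membership of [u] fixes the step at its far end. *)
Lemma tight_path X u : biclosed lambda X -> segment u -> tight X u ->
  exists a b, [/\ eta lambda X (a ++ u ++ b), bends (a ++ u ++ b) (u \in X) u
   & edge_split X (if u \in X then a else a ++ u) (if u \in X then u ++ b else b)].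
Proof.
move=> HX /and3P[un us ui] Hu.
suff [a [b [Hp Hb Hs]]] : exists a b, [/\ bpath (a ++ u ++ b), bends (a ++ u ++ b) (u \in X) u
   & edge_split X (if u \in X then a else a ++ u) (if u \in X then u ++ b else b)].
  exists a, b; split=> //; apply/etaP => //; have /andP[? ?] := bends_nonstraight Hb.
  split=> //; move: Hs Hp; case: ifP => _ Hs Hp; first exact: edge_split_compat HX Hp Hs.
  by move: Hp; rewrite catA => Hp; apply: edge_split_compat HX Hp Hs.
case uX : (u \in X).
- case/lastP: u un us ui Hu uX => // c z _ us; rewrite all_rcons => /andP[zi ci] Hu uX.
  have [b [Q [y [EQ sQ iQ Hy fQ]]]] := forward_ray us ci (interior_mem zi) (tight_frule Hu).
  set u := rcons c z in us Hu uX EQ *; have un : u != [::] by rewrite /u; case: (c).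
  have bn : b != [::].
    apply: contraTneq Hy => b0; move: EQ; rewrite b0 cats0 => /rcons_inj[_ <-].
    by rewrite /boundary zi andbF.
  set w := north (head origin u).
  have Hw : w \in lambda.
    have : all (interior lambda) u by rewrite all_rcons zi.
    by rewrite /w; case: (u) un => //= v s _ /andP[/and5P[]].
  (* The other ray starts at the single vertex [w], where the rule is vacuous. *)
  have [|a [x [P [EP sP iP Hx bP]]]] := @backward_ray X w [::] isT isT Hw.
    by move=> [|t [|t' a]] [|t'' c'].
  have Elast : last x P = w.
    by rewrite -[last x P]/(last origin (x :: P)) -EP last_cat.
  have Hd : head origin (rcons Q y) = south (last x P).
    by rewrite -EQ Elast /w south_north; case: (u) un.
  have [Hp Hs] := edge_join sP sQ iP iQ Hx Hy Hd bP fQ.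
  exists (x :: P), b; rewrite EQ; split=> //.
  exists (x :: P), b; rewrite EQ; split=> //; first by rewrite un bn.
    by case: Hs => /and3P[_ _]; rewrite -EQ est_catr // => /negbTE->.
  by rewrite (fQ u b).
- have [z [c Eu]] : exists z c, u = z :: c by case: (u) un => // z c _; exists z, c.
  have /andP[zi ci] : interior lambda z && all (interior lambda) c by rewrite Eu in ui.
  have [a [x [P [EP sP iP Hx bP]]]] : exists a x P, [/\ a ++ u = x :: P, sorted se_step (x :: P),
      all (interior lambda) P, boundary lambda x & brule X (x :: P)].
    by rewrite Eu; apply: backward_ray; rewrite -?Eu ?interior_mem //; apply: tight_brule.
  have an : a != [::].
    apply: contraTneq Hx => a0; move: EP; rewrite a0 Eu => -[<- _].
    by rewrite /boundary zi andbF.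
  set w := south (last origin u).
  have Hw : w \in lambda.
    have : interior lambda (last origin u).
      by rewrite Eu /=; have /allP := ui; apply; rewrite Eu; apply: mem_last.
    by case/and5P.
  have [|b [Q [y [EQ sQ iQ Hy fQ]]]] := @forward_ray X [::] w isT isT Hw.
    by move=> [|t [|t' d]] [|t'' c'].
  have Elast : last x P = last origin u.
    by rewrite -[last x P]/(last origin (x :: P)) -EP last_cat Eu.
  have Hd : head origin (rcons Q y) = south (last x P) by rewrite -EQ Elast.
  have [Hp Hs] := edge_join sP sQ iP iQ Hx Hy Hd bP fQ.
  have Qn : rcons Q y != [::] by case: (Q).
  exists a, (rcons Q y); split; rewrite ?EP //; first by rewrite catA EP.
  exists a, (rcons Q y); split; rewrite ?an ?un //; first by rewrite (bP a u) // uX.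
  by case: Hs => /and3P[_ _]; rewrite -EP est_catl // => /negbTE->.
Qed.

Lemma bends_split p d u c1 c2 : bends p d u -> u = c1 ++ c2 ->
  c1 != [::] -> c2 != [::] -> bends p d (if est c1 c2 == d then c1 else c2).
Proof.
move=> Hb E c1n c2n; apply: (part_bends Hb); case: eqP => Ed.
  by exists [::], c2; rewrite E.
by exists c1, [::]; rewrite E cats0; split=> // _; apply: neq_negb.
Qed.

(** Descent on the size of a wrongly placed bend. At a cut, [bends_split] gives a piece along which
    [q] bends the same way. It is either wrongly placed too, hence a smaller example, or
    biclosedness puts the other piece where tightness wants it. *)
Lemma bends_tight X q d u : biclosed lambda X -> bpath q -> bends q d u ->
  (u \in X) = ~~ d ->
  exists u', [/\ infix u' u, bends q d u', (u' \in X) = ~~ d & tight X u'].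
Proof.
move=> HX Hq; have [n] := ubnP (size u); elim: n u => // n IH u Hn Hb uX.
have [Ht|/existsNP[c1 /existsNP[c2]]] := pselect (tight X u).
  by exists u; split=> //; apply: infix_refl.
move=> /not_implyP[E /not_implyP[c1n /not_implyP[c2n Hnot]]].
have Hs := bends_segment Hq Hb; rewrite E in Hs.
have := bends_split Hb E c1n c2n; rewrite E in uX.
case: eqP => Ed Hb'.
- case c1X : ((c1 \in X) == ~~ d).
    have [|u' [i1 h1 h2 h3]] := IH c1 _ Hb' (eqP c1X).
      by move: Hn; rewrite E size_cat; move: (size_neq0 c2n); lia.
    by exists u'; split=> //; rewrite E; apply: infix_catr.
  case: Hnot; have {}c1X := neq_negbF c1X.
  split; first by rewrite Ed.
  by rewrite Ed; apply: (biclosed_catr HX Hs) => //; rewrite negbK.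
- have {}Ed := neq_negb Ed.
  case c2X : ((c2 \in X) == ~~ d).
    have [|u' [i1 h1 h2 h3]] := IH c2 _ Hb' (eqP c2X).
      by move: Hn; rewrite E size_cat; move: (size_neq0 c1n); lia.
    by exists u'; split=> //; rewrite E; apply: infix_catl.
  case: Hnot; have {}c2X := neq_negbF c2X.
  split; last by rewrite Ed negbK.
  by rewrite Ed; apply: (biclosed_catl HX Hs) => //; rewrite negbK.
Qed.

Lemma eta_nonkissing X : biclosed lambda X -> nonkissing_complex lambda (eta lambda X).
Proof.
move=> HX; split=> [p /(etaP _ HX)[-> -> -> _] //|p q /(etaP _ HX)[Hp _ _ cp] /(etaP _ HX)[Hq _ _ cq]].
move/(kissP Hp Hq) => [d [u [/cp h1 /cq]]]; rewrite h1.
by case: d {h1}.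
Qed.

(** A wrong bend of [q] shrinks to a tight segment, and the member of [eta X] following that segment
    bends there the opposite way, so it kisses [q]. *)
Lemma nonkissing_compat_sub X q : biclosed lambda X ->
  bpath q -> ~~ horizontal q -> ~~ vertical q ->
  (forall p, eta lambda X p -> ~ kiss lambda p q) -> eta lambda X q.
Proof.
move=> HX Hq Hh Hv Hk; apply/etaP => //; split=> // d u Hb.
apply: contrapT => /neq_negb nX.
have [u' [_ Hb' u'X Ht]] := bends_tight HX Hq Hb nX.
have [a [b [Hp Hpb _]]] := tight_path HX (bends_segment Hq Hb') Ht.
apply: (Hk _ Hp); apply/kissP => //; first by case/(etaP _ HX): Hp.
by exists (~~ d), u'; rewrite negbK -u'X.
Qed.

Lemma eta_GT X : biclosed lambda X -> GT lambda (eta lambda X).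
Proof.
move=> HX; split=> [|G [HG1 HG2] sub]; first exact: eta_nonkissing.
apply/seteqP; split=> // q Gq; have /and3P[? ? ?] := HG1 _ Gq.
by apply: nonkissing_compat_sub => // p /sub Gp; apply: HG2.
Qed.

End Rays.

(** * Facets and torsion classes *)

Section Torsion.
Variable lambda : grid_shape.
Local Notation segment := (is_segment lambda).
Local Notation bpath := (is_bpath lambda).

Lemma part_catl d a b : a != [::] -> b != [::] -> est a b = d -> part d (a ++ b) a.
Proof. by move=> an bn E; exists [::], b. Qed.

Lemma part_catr d a b : a != [::] -> b != [::] -> est a b = ~~ d -> part d (a ++ b) b.
Proof. by move=> an bn E; exists a, [::]; rewrite cats0. Qed.

Lemma part_cat_cases d a b t : part d (a ++ b) t ->
  [\/ part d a t, part d b t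
    | exists t1 t2, [/\ t = t1 ++ t2, part d a t1 & part d b t2]].
Proof.
move=> [c [e [E tn Hc He]]].
case/infix_cat_cases: (E) => [[f [Ea Eb]]|[f [Eb Ec]]|[x [u1 [y [u2 [Et Ea Eb]]]]]].
- constructor 1; exists c, f; split=> // fn; rewrite -He ?Eb ?est_catr //.
  exact: cat_neq0l.
- constructor 2; exists f, e; split=> // fn; rewrite -Hc ?Ec ?est_catl //.
  exact: cat_neq0r.
- constructor 3; exists (x :: u1), (y :: u2); split=> //.
    by exists c, [::]; rewrite cats0; split=> // cn; rewrite -Hc // Et est_catr.
  by exists [::], e; split=> // en; rewrite -He // Et est_catl.
Qed.

Definition tors (T : set (seq vertex)) : Prop :=
  [/\ T `<=` Seg lambda,
      forall a b, T a -> T b -> segment (a ++ b) -> T (a ++ b)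
    & forall s t, T s -> part true s t -> T t].

(** The direction of the step between [a] and [b] decides which of the two is an SW-subsegment of
    [a ++ b]. *)
Lemma tors_biclosed T : tors T -> biclosed lambda T.
Proof.
move=> [sub cl qu]; split=> // a b an bn Tab.
case E : (est a b); [left|right]; apply: (qu _ _ Tab).
  exact: part_catl.
by apply: part_catr => //; rewrite E.
Qed.

(** A path bending from West to South along [t] demands that [t] be excluded; ranging over all
    SW-subsegments makes the set closed under them. *)
Definition Tof (F : set (seq vertex)) : set (seq vertex) :=
  [set s | segment s /\ forall t p, part true s t -> F p -> ~ bends p false t].

Lemma tors_Tof F : tors (Tof F).
Proof.
split=> [s [] //|a b [Ha Fa] [Hb Fb] Hab|s t [Hs Fs] Hst].
- split=> // t p /part_cat_cases[h|h|[t1 [t2 [Et h1 h2]]]] Fp h'; [exact: Fa Fp h'|exact: Fb Fp h'|].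
  have := bends_split h' Et (part_neq0 h1) (part_neq0 h2).
  by case: ifP => _; [exact: Fa Fp|exact: Fb Fp].
- split=> [|u p Hu]; first exact: segment_part Hst.
  by apply: Fs; apply: part_trans Hu.
Qed.

(** [diag] fixes the position of every vertex in [s], so composable subsegments [a] and [b] are
    adjacent in [s]. Then [a ++ b] is entered like [a] and left like [b]. *)
Lemma tors_SW s : segment s -> tors (SW_subsegments lambda s).
Proof.
move=> Hs; split=> [t /and4P[] //|a b|t u]; rewrite !SW_subsegmentsP //; last first.
  exact: part_trans.
move=> [c1 [e1 [E1 an Hc1 _]]] [c2 [e2 [E2 bn _ He2]]] /segment_sorted Hab.
have Ss := segment_sorted Hs.
have a0 := size_neq0 an; have b0 := size_neq0 bn.
have sz1 : size s = (size c1 + size a + size e1)%N by rewrite E1 !size_cat addnA.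
have sz2 : size s = (size c2 + size b + size e2)%N by rewrite E2 !size_cat addnA.
have Hh : diag (head origin b) = (diag (head origin s) + (size c2)%:Z)%R.
  rewrite -se_sorted_diag //; last by rewrite sz2; lia.
  by rewrite {1}E2 nth_cat_head ?cat_neq0l //; case: (b) bn.
have Hl : diag (last origin a) = (diag (head origin s) + (size c1 + size a).-1%:Z)%R.
  rewrite -se_sorted_diag //; last by rewrite sz1; lia.
  rewrite {1}E1 catA -size_cat nth_cat_last ?cat_neq0r // last_cat.
  by case: (a) an.
have : diag (head origin b) = (diag (last origin a) + 1)%R.
  move: Hab; rewrite se_sorted_cat // => /and3P[_ _ /eqP Eh].
  apply: diag_se_step; rewrite /se_step /south_step /east_step {}Eh.
  by case: ifP; rewrite eqxx ?orbT.
rewrite Hh Hl => Ed; have Esz : size (c1 ++ a) = size c2 by rewrite size_cat; lia.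
have /eqP := E1; rewrite {1}E2 eq_sym catA eqseq_cat // => /andP[_ /eqP Ee].
exists c1, e2; split=> //; rewrite ?cat_neq0l //; first by rewrite E1 Ee !catA.
  by move=> h; rewrite est_catr // Hc1.
by move=> h; rewrite est_catl // He2.
Qed.

(** A compatible path never bends from West to South along a member of [T]. Conversely, a smallest
    SW-subsegment of [s] outside of [T] would be tight, and the path following it would bend along
    it from West to South. *)
Lemma Tof_eta T : tors T -> Tof (eta lambda T) = T.
Proof.
move=> HT; have HX := tors_biclosed HT; have [sub cl qu] := HT.
apply/seteqP; split=> [s [Hs Fs]|s Ts]; last first.
  split=> [|t p Hst /(etaP _ HX)[_ _ _ cp] /cp]; first exact: sub.
  by rewrite (mem_set (qu _ _ Ts Hst)).
suff H n t : (size t < n)%N -> part true s t -> T t.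
  by apply: (H (size s).+1) => //; apply/part_refl/(segment_neq0 Hs).
elim: n t => // n IH t Hn Hst; apply: contrapT => nT.
have nX : (t \in T) = false by apply/negP => /set_mem.
have Ht := segment_part Hs Hst.
have [|a [b [Hp Hb _]]] := tight_path HX Ht; last first.
  by rewrite nX in Hb; apply: (Fs t _ Hst Hp).
move=> c1 c2 E c1n c2n; have Hsz : (size t = size c1 + size c2)%N by rewrite E size_cat.
have c10 := size_neq0 c1n; have c20 := size_neq0 c2n.
rewrite E in Ht nX Hst; case Ec : (est c1 c2) => /=.
  have h1 : (c1 \in T) = true.
    apply/mem_set/IH; first by lia.
    by apply: part_trans Hst _; apply: part_catl.
  by split=> //; apply: (biclosed_catr HX Ht).
have h2 : (c2 \in T) = true.
  apply/mem_set/IH; first by lia.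
  by apply: part_trans Hst _; apply: part_catr; rewrite ?Ec.
by split=> //; apply: (biclosed_catl HX Ht).
Qed.

(** By maximality of [F] it suffices that its members are compatible: a bend from West to South
    excludes the segment by definition, and one from North to East includes it because [F] has no
    kisses. *)
Lemma eta_Tof F : GT lambda F -> eta lambda (Tof F) = F.
Proof.
move=> [[HF1 HF2] max]; have HX := tors_biclosed (tors_Tof F).
apply: max; first exact: eta_nonkissing.
move=> p Fp; have /and3P[Hp Hh Hv] := HF1 _ Fp.
apply/etaP => //; split=> // -[] u Hu; last first.
  apply/negP => /set_mem[Hs /(_ u p)]; apply=> //.
  exact/part_refl/bends_neq0/Hu.
apply/mem_set; split=> [|t q Hut Fq Hq]; first exact: bends_segment Hu.
apply: (HF2 _ _ Fp Fq); have /and3P[Hq' _ _] := HF1 _ Fq.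
by apply/kissP => //; exists true, t; split=> //; apply: part_bends Hut.
Qed.

(** Shrinking [s] to a tight [u] yields a member of [eta X] that kisses [q] along [u], hence [p],
    whose edge is next to [u]. Moreover [u] is all of [s]: inside [s] the two paths share their
    steps, but at both ends of [u] they take opposite ones. *)
Lemma kiss_edge_split X p q a s b d : biclosed lambda X -> eta lambda X p ->
  bpath q -> (forall r, eta lambda X r -> kiss lambda r q -> r = p) ->
  bends p d s -> bends q (~~ d) s -> p = a ++ s ++ b ->
  edge_split X (if d then a else a ++ s) (if d then s ++ b else b).
Proof.
move=> HX Hp Hq Hk Hps Hqs Ep; have [Hbp _ _ cp] := (etaP _ HX).1 Hp.
have sX : (s \in X) = ~~ ~~ d by rewrite negbK; apply: cp.
have [u [/infixP[x [y Es]] Hqu uX Ht]] := bends_tight HX Hq Hqs sX.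
rewrite negbK in uX.
have [a' [b' [Hr Hb]]] := tight_path HX (bends_segment Hq Hqu) Ht.
rewrite uX in Hb * => Hsplit.
have Er : a' ++ u ++ b' = p.
  apply: Hk => //; apply/kissP => //; first by case/(etaP _ HX): Hr.
  by exists d, u.
rewrite Er in Hb Hr.
have [c [e [Eq _ _ _]]] := Hqs.
have Sp := bpath_sorted Hbp; have Sq := bpath_sorted Hq.
have [_ _ p1 p2] := @bends_at _ _ _ (a ++ x) (y ++ b) Sp Hb ltac:(by rewrite Ep Es !catA).
have [_ _ q1 q2] := @bends_at _ _ _ (c ++ x) (y ++ e) Sq Hqu ltac:(by rewrite Eq Es !catA).
have x0 : x = [::].
  apply: contrapT => /eqP xn; move: p1 q1; rewrite !est_catl // => ->.
  by case: (d).
have y0 : y = [::].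
  apply: contrapT => /eqP yn; move: p2 q2; rewrite !est_catr // => ->.
  by case: (d).
have {}Es : s = u by rewrite Es x0 y0 cats0.
have [<- <-] // : a' = a /\ b' = b; last by rewrite Es.
apply: (@occurrence_uniq _ _ u); rewrite ?Er ?(bends_neq0 Hqu) //.
  exact: se_sorted_uniq.
by rewrite Ep Es.
Qed.

(** A failure would be a member of [F'] bending from West to South along a segment of [Tof F]. It
    can only be [q], and shrinking that segment makes [p] and [q] kiss a second time, in the other
    direction. *)
Lemma flip_Tof s F F' : flip lambda s F F' -> Tof F `<=` Tof F'.
Proof.
move=> [HF HF' Hs [p [q [Fp F'q npq EFF kpq]]]].
have [[HF1 _] _] := HF; have [[HF1' HF2'] _] := HF'.
have /and3P[Hp _ _] := HF1 _ Fp; have /and3P[Hq _ _] := HF1' _ F'q.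
have Sp := bpath_sorted Hp; have Sq := bpath_sorted Hq.
have [Hps Hqs] := (kiss_orientedP Sp Sq (segment_neq0 Hs)).1 kpq.
have HT := tors_Tof F; have HX := tors_biclosed HT.
have onlyp r : eta lambda (Tof F) r -> kiss lambda r q -> r = p.
  rewrite eta_Tof // => Fr Hk; apply: contrapT => nrp.
  have : (F `\ p) r by split.
  by rewrite EFF => -[F'r _]; apply: (HF2' _ _ F'r F'q Hk).
move=> t Tt; split=> [|u r Htu F'r Hr]; first by case: Tt.
have Tu : Tof F u by case: HT => _ _; apply; [exact: Tt | exact: Htu].
have rq : r = q.
  apply: contrapT => nrq; have : (F' `\ q) r by split.
  by rewrite -EFF => -[Fr _]; case: Tt => _ /(_ u r Htu Fr).
subst r; have uX : (u \in Tof F) = ~~ false by apply/mem_set.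
have [u' [_ Hqu u'X Ht]] := bends_tight HX Hq Hr uX.
have [a' [b' [Hr' Hb' _]]] := tight_path HX (bends_segment Hq Hqu) Ht.
rewrite u'X /= in Hb'.
have Er : a' ++ u' ++ b' = p.
  apply: onlyp => //; apply/kissP => //; first by case/(etaP _ HX): Hr'.
  by exists true, u'.
rewrite Er in Hb' Hr'.
have [a [b [Ep /and3P[an sn bn] _ _]]] := Hps.
have /= S1 := kiss_edge_split HX Hr' Hq onlyp Hps Hqs Ep.
have /= S2 := kiss_edge_split HX Hr' Hq onlyp Hb' Hqu (esym Er).
(* [S1] puts the marked edge of [p] just after [s] and [S2] puts it just before [u'], so in [p] the
   segment [u'] follows [s] by a South step. *)
have Ea : a ++ s = a'.
  by apply: (edge_split_uniq S1 S2); rewrite -catA -Ep -Er.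
have Eb : b = u' ++ b'.
  move: Er; rewrite {1}Ep -Ea -!catA => /eqP.
  by rewrite !eqseq_cat // !eqxx => /eqP->.
have un := bends_neq0 Hqu.
have su : head origin u' = south (last origin s).
  have : sorted se_step (s ++ u').
    have := Sp; rewrite Ep Eb => /se_sorted_catr; rewrite catA.
    exact: se_sorted_catl.
  move/est_head => ->//; case: S1 => /and3P[_ _]; rewrite est_catl // Eb est_catr //.
  by move/negbTE->.
have [c [e [Eq /and3P[_ _ en] _ se]]] := Hqs.
have [c' [e' [Eq' _ _ _]]] := Hqu.
(* [q] leaves [s] to the East but also visits the first vertex of [u']: two vertices of one path
   with the same [diag]. *)
have h1 : south (last origin s) \in q.
  by rewrite -su Eq' !mem_cat; case: (u') un => // z u'' _; rewrite mem_head orbT.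
have h2 : east (last origin s) \in q.
  have : sorted se_step (s ++ e) by have := Sq; rewrite Eq => /se_sorted_catr.
  move/est_head; rewrite se => <- //.
  by rewrite Eq !mem_cat; case: (e) en => // z u'' _; rewrite mem_head !orbT.
have : south (last origin s) = east (last origin s).
  by apply: (se_sorted_diag_inj Sq h1 h2); rewrite diag_south diag_east.
by move/eqP; rewrite south_neq_east.
Qed.

Lemma GT_le_Tof F F' : GT_le lambda F F' -> Tof F `<=` Tof F'.
Proof.
elim=> [G G' [s /flip_Tof]|G|G G' G'' _ h1 _ h2] //.
exact: subset_trans h2.
Qed.

End Torsion.

(** * Chains of biclosed sets *)

Section Bic.
Variable lambda : grid_shape.
Local Notation segment := (is_segment lambda).
Local Notation bpath := (is_bpath lambda).

Fixpoint words (n : nat) : seq (seq vertex) :=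
  if n is m.+1 then [::] :: [seq x :: l | x <- enum_fset lambda, l <- words m]
  else [:: [::]].

Lemma mem_words n (s : seq vertex) : all (mem lambda) s -> (size s <= n)%N -> s \in words n.
Proof.
elim: n s => [|n IH] [|x s] // /andP[xl sl] sn; rewrite inE; apply/orP; right.
by apply/allpairsP; exists (x, s); split=> //; apply: IH.
Qed.

Lemma segment_size s : segment s -> (size s <= shape_size lambda)%N.
Proof.
case/and3P=> _ Ss Is; apply: sorted_size_le => //; apply: sub_all Is => v.
exact: interior_mem.
Qed.

Lemma segments_finite : exists L : seq (seq vertex), forall s, segment s -> s \in L.
Proof.
exists (words (shape_size lambda)) => s Hs; apply: mem_words; last exact: segment_size.
by case/and3P: Hs => _ _; apply: sub_all => v; apply: interior_mem.
Qed.

(** A finite list contains all segments, and each newly added segment lowers the number of listed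
    words outside of the set. *)
Lemma segment_set_ind (P : set (seq vertex) -> Prop) :
  (forall X, (forall X', X `<=` X' -> (exists2 s, segment s & X' s /\ ~ X s) -> P X') -> P X) ->
  forall X, P X.
Proof.
move=> H X; have [L HL] := segments_finite.
pose out (Z : set (seq vertex)) := [seq s <- undup L | s \notin Z].
have [n] := ubnP (size (out X)); elim: n X => // n IH X Hn.
apply: H => X' sub [s Hs [X's nXs]]; apply: IH.
apply: (@leq_trans (size (out X))); last by rewrite -ltnS.
rewrite -[(size _).+1]/(size (s :: out X')).
apply: uniq_leq_size => [|t].
  by rewrite /= mem_filter mem_set //= filter_uniq // undup_uniq.
rewrite inE => /orP[/eqP->|]; rewrite !mem_filter mem_undup.
  by rewrite HL // andbT; apply/negP => /set_mem.
by case/andP => h ->; rewrite andbT; apply: contraNN h => /set_mem/sub/mem_set.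
Qed.

(** * Finding a segment that can be added to a biclosed set *)

Section Step.
Variables X Y : set (seq vertex).
Hypotheses (HX : biclosed lambda X) (HY : biclosed lambda Y) (XY : X `<=` Y).

(** The condition on the cuts is what keeps the complement closed under concatenation once [s] is
    added to [X]. *)
Let good s := [/\ Y s, ~ X s & forall a b : seq vertex, s = a ++ b ->
  a != [::] -> b != [::] -> X a \/ X b].

(** A bad cut of [s ++ t] cannot fall inside [s], where the piece of [s] next to [t] would be in [X]
    and absorb [t]. So it cuts [t], whose initial piece is in [X] and is a shorter candidate. This
    is how a longest good segment preserves closure. *)
Lemma good_extend_right s t : good s -> X t -> segment (s ++ t) -> ~ X (s ++ t) ->
  exists t', good (s ++ t') /\ t' != [::].
Proof.
have [_ clX cclX] := HX; have [subY clY _] := HY.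
move=> [Ys nXs gs]; have [n] := ubnP (size t); elim: n t => // n IH t Hn Xt Hst nXst.
have sn := segment_neq0 (subY _ Ys).
have tn : t != [::] by apply/eqP => t0; move: nXst (Ys) Xt; case: HX => sub _ _; rewrite t0 => _ _ /sub.
have [Hg|/existsNP[a /existsNP[b]]] := pselect (forall a b : seq vertex, s ++ t = a ++ b ->
    a != [::] -> b != [::] -> X a \/ X b).
  by exists t; split=> //; split=> //; apply: clY => //; apply: XY.
move=> /not_implyP[E /not_implyP[an /not_implyP[bn /not_orP[nXa nXb]]]].
case/eq_cat_cases: E => [[e [Ea Et]]|[x [e [Es Eb]]]]; last first.
  case: (gs _ _ Es) => // h; case: nXb; rewrite Eb -cat_cons; apply: clX => //.
  by move: Hst; rewrite Es -catA => /segment_catr; rewrite cat_neq0l // => ->.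
have en : e != [::] by apply/eqP => e0; apply: nXb; rewrite -[b]/([::] ++ b) -e0 -Et.
have Xe : X e by case: (cclX e b) => //; rewrite -Et.
apply: (IH e) => //.
- by move: Hn; rewrite Et size_cat; move: (size_neq0 bn); lia.
- by move: Hst; rewrite Et catA => /segment_catl; apply; apply: cat_neq0l.
- by rewrite -Ea.
Qed.

Lemma good_extend_left s t : good s -> X t -> segment (t ++ s) -> ~ X (t ++ s) ->
  exists t', good (t' ++ s) /\ t' != [::].
Proof.
have [_ clX cclX] := HX; have [subY clY _] := HY.
move=> [Ys nXs gs]; have [n] := ubnP (size t); elim: n t => // n IH t Hn Xt Hst nXst.
have sn := segment_neq0 (subY _ Ys).
have tn : t != [::] by apply/eqP => t0; move: nXst (Ys) Xt; case: HX => sub _ _; rewrite t0 => _ _ /sub.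
have [Hg|/existsNP[a /existsNP[b]]] := pselect (forall a b : seq vertex, t ++ s = a ++ b ->
    a != [::] -> b != [::] -> X a \/ X b).
  by exists t; split=> //; split=> //; apply: clY => //; apply: XY.
move=> /not_implyP[E /not_implyP[an /not_implyP[bn /not_orP[nXa nXb]]]].
case/eq_cat_cases: E => [[e [Ea Es]]|[x [e [Et Eb]]]].
  have [e0|en] := eqVneq e [::]; first by case: nXa; rewrite Ea e0 cats0.
  case: (gs _ _ Es) => // h; case: nXa; rewrite Ea; apply: clX => //.
  by move: Hst; rewrite Es catA => /segment_catl; rewrite cat_neq0l // => ->.
have Xe : X (x :: e) by case: (cclX a (x :: e)) => //; rewrite -Et.
apply: (IH (x :: e)) => //.
- by move: Hn; rewrite Et size_cat; move: (size_neq0 an); lia.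
- by move: Hst; rewrite Et -catA => /segment_catr; apply.
- by rewrite cat_cons -Eb.
Qed.

(* The segment s is a longest one with no decomposition into two segments
   outside of X. *)
Lemma biclosed_step : (exists2 s, Y s & ~ X s) ->
  exists s, [/\ Y s, ~ X s & biclosed lambda (X `|` [set s])].
Proof.
have [subX clX cclX] := HX; have [subY clY cclY] := HY.
move=> [s0 Ys0 nXs0].
(* If both pieces of a cut are outside of [X], one of them is still in [Y]; descending to it ends at
   a good segment. *)
have [s1 Gs1] : exists s, good s.
  have [n] := ubnP (size s0); elim: n s0 Ys0 nXs0 => // n IH s Ys nXs Hn.
  have [Hg|/existsNP[a /existsNP[b]]] := pselect (forall a b : seq vertex, s = a ++ b ->
    a != [::] -> b != [::] -> X a \/ X b); first by exists s.
  move=> /not_implyP[E /not_implyP[an /not_implyP[bn /not_orP[nXa nXb]]]].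
  have sz : size s = (size a + size b)%N by rewrite E size_cat.
  have a0 := size_neq0 an; have b0 := size_neq0 bn.
  case: (cclY a b) => // [|Ya|Yb]; first by rewrite -E.
    by apply: (IH a) => //; lia.
  by apply: (IH b) => //; lia.
have [s Gs maxs] : exists2 s, good s & forall t, good t -> (size t <= size s)%N.
  apply: contrapT => Hno.
  have Hlong n : exists2 s, good s & (n <= size s)%N.
    elim: n => [|n [s Gs Hn]]; first by exists s1.
    apply: contrapT => Hno'; apply: Hno; exists s => // t Gt.
    by rewrite leqNgt; apply/negP => h; apply: Hno'; exists t => //; lia.
  have [s [Ys _ _] Hs] := Hlong (shape_size lambda).+1.
  by have := segment_size (subY _ Ys); lia.
have [Ys nXs gs] := Gs; have Hs := subY _ Ys.
exists s; split=> //; split=> [t [/subX|->] //|a b|a b an bn].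
- move=> [Xa|->] [Xb|->] Hab.
  + by left; apply: clX.
  + left; apply: contrapT => nX; have [t [/maxs]] := good_extend_left Gs Xa Hab nX.
    by rewrite size_cat => h /size_neq0; lia.
  + left; apply: contrapT => nX; have [t [/maxs]] := good_extend_right Gs Xb Hab nX.
    by rewrite size_cat => h /size_neq0; lia.
  (* [s ++ s] is no segment, since it repeats vertices. *)
  + have := se_sorted_uniq (segment_sorted Hab); rewrite cat_uniq => /and3P[_ /hasPn h _].
    by case: (s) (segment_neq0 Hs) h => // x s' _ /(_ x (mem_head _ _)); rewrite mem_head.
- move=> [/cclX[]// ?|/esym/gs[]// ?]; by [left; left|right; left].
Qed.

End Step.

(** The vertices of a path strictly between its ends are interior, so a path cannot run past the
    point where another one ends. *)
Lemma bpath_prefix_max p1 p2 (a1 a2 b c : seq vertex) : bpath p1 -> bpath p2 ->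
  p1 = a1 ++ b ++ c -> p2 = a2 ++ b -> a1 != [::] -> b != [::] -> c = [::].
Proof.
move=> H1 /bpathP[x [m [y [E2 _ Hy _ _]]]] E1 E2' an bn; apply: contrapT => /eqP cn.
have /and3P[_ _ /allP Ib] : segment b by apply: (@bpath_segment _ a1 b c); rewrite -?E1.
have : interior lambda y.
  apply: Ib; rewrite -[y](last_rcons x m) -[last x _]/(last origin (x :: rcons m y)) -E2 E2'.
  by rewrite last_cat; case: (b) bn => // z b' _; apply: (mem_last z b').
by case/andP: Hy => _ /negbTE->.
Qed.

Lemma bpath_suffix_max p1 p2 (a b1 b2 c : seq vertex) : bpath p1 -> bpath p2 ->
  p1 = c ++ a ++ b1 -> p2 = a ++ b2 -> b1 != [::] -> a != [::] -> c = [::].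
Proof.
move=> H1 /bpathP[x [m [y [E2 Hx _ _ _]]]] E1 E2' bn an; apply: contrapT => /eqP cn.
have /and3P[_ _ /allP Ia] : segment a by apply: (@bpath_segment _ c a b1); rewrite -?E1.
have : interior lambda x.
  apply: Ia; rewrite -[x]/(head origin (x :: rcons m y)) -E2 E2'.
  by case: (a) an => // z a' _; apply: mem_head.
by case/andP: Hx => _ /negbTE->.
Qed.

(** * The flip caused by adding one segment *)

Section AddOne.
Variables (X : set (seq vertex)) (s : seq vertex).
(** One boolean covers both sides of the step: [s] is in [Xs d] exactly when [d] holds, and nothing
    else depends on [d]. *)
Let Xs (d : bool) := if d then X `|` [set s] else X.
Hypotheses (nXs : ~ X s) (HXs : forall d, biclosed lambda (Xs d)).

Lemma mem_addone u : (u \in X `|` [set s]) = (u \in X) || (u == s).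
Proof.
apply/idP/orP => [/set_mem[/mem_set->|->]|[/set_mem h|/eqP->]]; rewrite ?eqxx; try by [left|right].
- by apply/mem_set; left.
- by apply/mem_set; right.
Qed.

Lemma mem_Xs d u : u != s -> (u \in Xs d) = (u \in X).
Proof. by rewrite /Xs; case: d; rewrite ?mem_addone // => /negbTE->; rewrite orbF. Qed.

Lemma mem_Xs_s d : (s \in Xs d) = d.
Proof. by case: d; rewrite /Xs ?mem_addone ?eqxx ?orbT //; apply/negP => /set_mem. Qed.

Lemma eta_diff_bends d p : eta lambda (Xs d) p -> ~ eta lambda (Xs (~~ d)) p ->
  bends p d s.
Proof.
move=> /(etaP _ (HXs _))[Hp Hh Hv Hc] Hn; apply: contrapT => nb; apply: Hn.
apply/etaP => //; split=> // d' u Hu.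
have [us|us] := eqVneq u s; last by rewrite mem_Xs // -(Hc _ _ Hu) mem_Xs.
rewrite us mem_Xs_s; rewrite us in Hu.
have /neq_negb-> // : d' <> d by move=> dd; apply: nb; rewrite -dd.
Qed.

(** The sets [Xs d] and [Xs (~~ d)] agree on [c] and [z]. In [Xs (~~ d)] both [s] and [c] have the
    status [~~ d], hence so has [z], against the assumption. *)
Lemma no_common_extension d (c z : seq vertex) : segment z -> c != [::] ->
  z = s ++ c \/ z = c ++ s -> (c \in Xs d) = ~~ d -> (z \in Xs d) = d -> False.
Proof.
move=> Hz cn Ez Hc Hzd.
have sn : s != [::].
  have [+ _ _] := HXs true; move=> /(_ s) h; apply: segment_neq0; apply: h.
  by apply/set_mem; rewrite mem_Xs_s.
have Us := se_sorted_uniq (segment_sorted Hz).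
have cs : c != s.
  apply/eqP => cs; move: Us; case: Ez => ->; rewrite cs cat_uniq => /and3P[_ /hasPn h _];
  by case: (s) sn h => // x s' _ /(_ x (mem_head _ _)); rewrite mem_head.
have zs : z != s.
  apply/eqP => /(congr1 (@size vertex)) h; have := size_neq0 cn.
  by case: Ez h => ->; rewrite size_cat; lia.
have Hc' : (c \in Xs (~~ d)) = ~~ d by rewrite mem_Xs // -(mem_Xs d).
have : (z \in Xs (~~ d)) = ~~ d.
  by case: Ez Hz => -> Hz; apply: (biclosed_cat (HXs _)) => //; rewrite mem_Xs_s.
by rewrite mem_Xs // -(mem_Xs d) // Hzd; case: (d).
Qed.

(** If the paths part after [s ++ c] with [c] nonempty, one bends along [s ++ c] in direction [d]
    and the other along [c] in direction [~~ d], which [no_common_extension] forbids. If [c] is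
    empty, both leave [s] the same way. *)
Lemma no_right_divergence d (p1 p2 a1 a2 c : seq vertex) x y (r1 r2 : seq vertex) :
  eta lambda (Xs d) p1 -> eta lambda (Xs d) p2 -> bends p1 d s -> bends p2 d s ->
  p1 = a1 ++ s ++ c ++ x :: r1 -> p2 = a2 ++ s ++ c ++ y :: r2 -> x = y.
Proof.
move=> Hp1 Hp2 Hb1 Hb2 E1 E2.
have [Bp1 _ _ C1] := (etaP _ (HXs d)).1 Hp1; have [Bp2 _ _ C2] := (etaP _ (HXs d)).1 Hp2.
have S1 := bpath_sorted Bp1; have S2 := bpath_sorted Bp2.
have sn := bends_neq0 Hb1; have scn : s ++ c != [::] by apply: cat_neq0l.
have [a1n _ f1 g1] := bends_at S1 Hb1 E1; have [a2n _ f2 g2] := bends_at S2 Hb2 E2.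
have Hx : x = (if est (s ++ c) (x :: r1) then east else south) (last origin (s ++ c)).
  rewrite -[LHS]/(head origin (x :: r1)) (est_head (a := s ++ c)) // -catA.
  by have := S1; rewrite E1 => /se_sorted_catr.
have Hy : y = (if est (s ++ c) (y :: r2) then east else south) (last origin (s ++ c)).
  rewrite -[LHS]/(head origin (y :: r2)) (est_head (a := s ++ c)) // -catA.
  by have := S2; rewrite E2 => /se_sorted_catr.
have [c0|cn] := eqVneq c [::].
  by rewrite c0 /= in g1 g2; rewrite Hx Hy c0 cats0 g1 g2.
(* By symmetry [p1] is the path that leaves [s ++ c] in direction [d]. *)
wlog e1 : p1 p2 a1 a2 x y r1 r2 Hp1 Hp2 Hb1 Hb2 E1 E2 Bp1 Bp2 C1 C2 S1 S2
    a1n a2n f1 f2 g1 g2 Hx Hy / est (s ++ c) (x :: r1) = d.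
  move=> W; have [e1|/neq_negb e1] := pselect (est (s ++ c) (x :: r1) = d); first by apply: (W p1 p2 a1 a2 x y r1 r2).
  have [e2|/neq_negb e2] := pselect (est (s ++ c) (y :: r2) = d).
    by symmetry; apply: (W p2 p1 a2 a1 y x r2 r1).
  by rewrite Hx Hy e1 e2.
have [e2|/neq_negb e2] := pselect (est (s ++ c) (y :: r2) = d); first by rewrite Hx Hy e1 e2.
case: (@no_common_extension d c (s ++ c)) => //.
- apply: (@bpath_segment _ a1 (s ++ c) (x :: r1)) => //.
  by rewrite -!catA -E1.
- by left.
- apply: C2; exists (a2 ++ s), (y :: r2); split; rewrite ?E2 ?catA ?cat_neq0r ?cn //.
    by rewrite est_catl // -g2 est_catr // negbK.
  by rewrite -e2 est_catl.
- apply: C1; exists a1, (x :: r1); split; rewrite ?E1 ?catA ?a1n ?scn //.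
  by rewrite est_catr.
Qed.

Lemma no_left_divergence d (p1 p2 b1 b2 c : seq vertex) x y (r1 r2 : seq vertex) :
  eta lambda (Xs d) p1 -> eta lambda (Xs d) p2 -> bends p1 d s -> bends p2 d s ->
  p1 = rcons r1 x ++ c ++ s ++ b1 -> p2 = rcons r2 y ++ c ++ s ++ b2 -> x = y.
Proof.
move=> Hp1 Hp2 Hb1 Hb2 E1 E2.
have [Bp1 _ _ C1] := (etaP _ (HXs d)).1 Hp1; have [Bp2 _ _ C2] := (etaP _ (HXs d)).1 Hp2.
have S1 := bpath_sorted Bp1; have S2 := bpath_sorted Bp2.
have sn := bends_neq0 Hb1; have csn : c ++ s != [::] by apply: cat_neq0r.
have E1' : p1 = (rcons r1 x ++ c) ++ s ++ b1 by rewrite E1 !catA.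
have E2' : p2 = (rcons r2 y ++ c) ++ s ++ b2 by rewrite E2 !catA.
have [_ b1n f1 g1] := bends_at S1 Hb1 E1'; have [_ b2n f2 g2] := bends_at S2 Hb2 E2'.
have rn (r : seq vertex) z : rcons r z != [::] by case: (r).
have Hx : x = (if est (rcons r1 x) (c ++ s) then west else north) (head origin (c ++ s)).
  rewrite -[LHS](last_rcons origin r1) (est_last (b := c ++ s)) //.
  by have := S1; rewrite E1 !catA => /se_sorted_catl; rewrite -catA.
have Hy : y = (if est (rcons r2 y) (c ++ s) then west else north) (head origin (c ++ s)).
  rewrite -[LHS](last_rcons origin r2) (est_last (b := c ++ s)) //.
  by have := S2; rewrite E2 !catA => /se_sorted_catl; rewrite -catA.
have [c0|cn] := eqVneq c [::].
  by rewrite c0 !cats0 in f1 f2; rewrite Hx Hy c0 f1 f2.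
wlog e1 : p1 p2 b1 b2 x y r1 r2 Hp1 Hp2 Hb1 Hb2 E1 E2 E1' E2' Bp1 Bp2 C1 C2 S1 S2
    b1n b2n f1 f2 g1 g2 Hx Hy / est (rcons r1 x) (c ++ s) = ~~ d.
  move=> W; have [e1|/neq_negb e1] := pselect (est (rcons r1 x) (c ++ s) = ~~ d); first by apply: (W p1 p2 b1 b2 x y r1 r2).
  have [e2|/neq_negb e2] := pselect (est (rcons r2 y) (c ++ s) = ~~ d).
    by symmetry; apply: (W p2 p1 b2 b1 y x r2 r1).
  by rewrite Hx Hy e1 e2.
have [e2|/neq_negb e2] := pselect (est (rcons r2 y) (c ++ s) = ~~ d); first by rewrite Hx Hy e1 e2.
case: (@no_common_extension d c (c ++ s)) => //.
- apply: (@bpath_segment _ (rcons r1 x) (c ++ s) b1) => //.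
  by rewrite -!catA -E1.
- by right.
- apply: C2; exists (rcons r2 y), (s ++ b2); split; rewrite ?rn ?cn ?cat_neq0l //.
    by rewrite -e2 est_catr.
  by rewrite -f2 est_catr // est_catl.
- apply: C1; exists (rcons r1 x), b1; split; rewrite ?E1 -?catA ?rn ?csn //.
  by rewrite est_catl.
Qed.

(** On either side of [s] the two paths never part, and neither stops before the other because its
    end is a boundary vertex. *)
Lemma bends_addone_uniq d p1 p2 :
  eta lambda (Xs d) p1 -> eta lambda (Xs d) p2 -> bends p1 d s -> bends p2 d s ->
  p1 = p2.
Proof.
move=> Hp1 Hp2 Hb1 Hb2.
have [Bp1 _ _ _] := (etaP _ (HXs d)).1 Hp1; have [Bp2 _ _ _] := (etaP _ (HXs d)).1 Hp2.
have [a1 [b1 [E1 /and3P[a1n sn b1n] _ _]]] := Hb1.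
have [a2 [b2 [E2 /and3P[a2n _ b2n] _ _]]] := Hb2.
have sb (a : seq vertex) : a != [::] -> a ++ s != [::] by move=> h; apply: cat_neq0l.
have Eb : b1 = b2.
  case: (cat_diverge b1 b2) => // [[x [c Eb]]|[x [c Eb]]|[c [x [y [r1 [r2 [F1 F2 /eqP[]]]]]]]].
  - by have := bpath_prefix_max Bp1 Bp2 (a1 := a1 ++ s) (a2 := a2 ++ s) (b := b2) (c := x :: c);
       rewrite E1 E2 Eb !catA sb // => /(_ erefl erefl isT b2n).
  - by have := bpath_prefix_max Bp2 Bp1 (a1 := a2 ++ s) (a2 := a1 ++ s) (b := b1) (c := x :: c);
       rewrite E1 E2 Eb !catA sb // => /(_ erefl erefl isT b1n).
  - by apply: (no_right_divergence Hp1 Hp2 Hb1 Hb2 (c := c)); rewrite ?E1 ?E2 ?F1 ?F2.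
(* Reversal lets the left sides be compared outward from [s]. *)
suff Ea : rev a1 = rev a2 by rewrite E1 E2 Eb -[a1]revK Ea revK.
case: (cat_diverge (rev a1) (rev a2)) => // [[x [c /(congr1 rev)]]|[x [c /(congr1 rev)]]|].
- rewrite revK rev_cat rev_cons revK => Ea.
  have := bpath_suffix_max Bp1 Bp2 (a := a2) (b1 := s ++ b1) (b2 := s ++ b2) (c := rcons (rev c) x).
  by rewrite E1 E2 Ea !catA cat_neq0r // => /(_ erefl erefl isT a2n); case: (rev c).
- rewrite revK rev_cat rev_cons revK => Ea.
  have := bpath_suffix_max Bp2 Bp1 (a := a1) (b1 := s ++ b2) (b2 := s ++ b1) (c := rcons (rev c) x).
  by rewrite E1 E2 Ea !catA cat_neq0r // => /(_ erefl erefl isT a1n); case: (rev c).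
- move=> [c [x [y [r1 [r2 [/(congr1 rev) F1 /(congr1 rev) F2 /eqP[]]]]]]].
  rewrite !revK !rev_cat !rev_cons in F1 F2.
  by apply: (no_left_divergence Hp1 Hp2 Hb1 Hb2 (c := rev c)); rewrite ?E1 ?E2 ?F1 ?F2 -?catA.
Qed.

(** Compatibility of [p] places one piece of each cut, and the membership of [s] in [Xs true] forces
    the other. *)
Lemma addone_tight p : eta lambda (Xs false) p -> bends p false s ->
  tight (Xs true) s.
Proof.
move=> Hp Hb c1 c2 E c1n c2n.
have [Bp _ _ Cp] := (etaP _ (HXs false)).1 Hp.
have sz (c : seq vertex) : (size c < size s)%N -> (c == s) = false.
  by apply: contraTF => /eqP->; rewrite ltnn.
have Es : size s = (size c1 + size c2)%N by rewrite E size_cat.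
have c1s : c1 != s by rewrite sz // Es; move: (size_neq0 c2n); lia.
have c2s : c2 != s by rewrite sz // Es; move: (size_neq0 c1n); lia.
have Hs : segment (c1 ++ c2) by rewrite -E; apply: bends_segment Bp Hb.
have sX : (c1 ++ c2 \in Xs true) = true by rewrite -E mem_Xs_s.
have := bends_split Hb E c1n c2n; case: (est c1 c2) => /Cp /= h.
  have h2 : (c2 \in Xs true) = false by rewrite mem_Xs // -(mem_Xs false).
  by split=> //; apply: (biclosed_catl (HXs true) Hs).
have h1 : (c1 \in Xs true) = false by rewrite mem_Xs // -(mem_Xs false).
by split=> //; apply: (biclosed_catr (HXs true) Hs).
Qed.

(** Either no path is lost and maximality gives equality, or the lost path [p] bends from West to
    South along [s] and the path gained is the one following the now tight [s]. By
    [bends_addone_uniq] nothing else changes. *)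
Lemma eta_addone_le : GT_le lambda (eta lambda (Xs false)) (eta lambda (Xs true)).
Proof.
have [GX GX'] := (eta_GT (HXs false), eta_GT (HXs true)).
have [sub|/existsNP[p /not_implyP[Hp Hp']]] :=
  pselect (eta lambda (Xs false) `<=` eta lambda (Xs true)).
  by case: GX => _ /(_ _ GX'.1 sub) ->; apply: rt_refl.
have Hb := @eta_diff_bends false p Hp Hp'.
have [Bp _ _ _] := (etaP _ (HXs false)).1 Hp.
have Hs := bends_segment Bp Hb.
have [a [b [Hq]]] := tight_path (HXs true) Hs (addone_tight Hp Hb).
rewrite mem_Xs_s; move: (a ++ s ++ b) Hq => q Hq Hbq _.
have [Bq _ _ Cq] := (etaP _ (HXs true)).1 Hq.
have Hq' : ~ eta lambda (Xs false) q.
  by move=> /(etaP _ (HXs false))[_ _ _ /(_ _ _ Hbq)]; rewrite mem_Xs_s.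
apply: rt_step; exists s; split=> //; exists p, q; split=> //.
- by move=> pq; rewrite pq in Hp.
- apply/seteqP; split=> [r [Hr rp]|r [Hr rq]].
    have Hr' : eta lambda (Xs true) r.
      apply: contrapT => /(@eta_diff_bends false r Hr) Hrb; apply: rp.
      exact: bends_addone_uniq Hr Hp Hrb Hb.
    by split=> // rq; rewrite rq in Hr.
  have Hr' : eta lambda (Xs false) r.
    apply: contrapT => /(@eta_diff_bends true r Hr) Hrb; apply: rq.
    exact: bends_addone_uniq Hr Hq Hrb Hbq.
  by split=> // rp; rewrite rp in Hr.
- by apply/kiss_orientedP; rewrite ?(bends_neq0 Hb) //; apply: bpath_sorted; [exact: Bp|exact: Bq].
Qed.

End AddOne.
Lemma biclosed_GT_le X Y : biclosed lambda X -> biclosed lambda Y -> X `<=` Y ->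
  GT_le lambda (eta lambda X) (eta lambda Y).
Proof.
move=> + HY; elim/segment_set_ind: X => X IH HX XY.
have [YX|/existsNP[s /not_implyP[Ys nXs]]] := pselect (Y `<=` X).
  by rewrite (_ : X = Y); [apply: rt_refl | apply/seteqP].
have [|t [Yt nXt HXt]] := biclosed_step HX HY XY; first by exists s.
apply: (@rt_trans _ _ _ (eta lambda (X `|` [set t]))).
  by apply: (@eta_addone_le X t nXt) => -[].
apply: IH => //.
- by exists t; [case: HY => + _ _; apply | split=> //; right].
- by move=> u [/XY|->].
Qed.

End Bic.

(** * Canonical join representations *)

Section Lattice.
Variable lambda : grid_shape.
Local Notation segment := (is_segment lambda).

(** Flips enlarge [Tof], and an inclusion of torsion classes refines to a chain of flips. *)
Lemma GT_leP F F' : GT lambda F -> GT lambda F' ->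
  GT_le lambda F F' <-> Tof lambda F `<=` Tof lambda F'.
Proof.
move=> HF HF'; split; first exact: GT_le_Tof.
rewrite -{2}(eta_Tof HF) -{2}(eta_Tof HF').
by apply: biclosed_GT_le; apply/tors_biclosed/tors_Tof.
Qed.

Inductive cl (Y : set (seq vertex)) : set (seq vertex) :=
| cl_base s : Y s -> cl Y s
| cl_concat a b : cl Y a -> cl Y b -> segment (a ++ b) -> cl Y (a ++ b).

Definition quotient_closed (Y : set (seq vertex)) : Prop :=
  Y `<=` Seg lambda /\ forall s t, Y s -> part true s t -> Y t.

(** An SW-subsegment of a concatenation is one of a single factor or a concatenation of
    SW-subsegments of both. *)
Lemma tors_cl Y : quotient_closed Y -> tors lambda (cl Y).
Proof.
move=> [sub qu]; split=> [s|a b|s t Hs].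
- by case=> // t /sub.
- exact: cl_concat.
elim: Hs t => [{}s Ys t|a b _ IHa _ IHb Hab t Ht]; first by move/qu => /(_ Ys)/cl_base.
have Hseg := segment_part Hab Ht.
case/part_cat_cases: Ht => [/IHa|/IHb|[t1 [t2 [E /IHa h1 /IHb h2]]]] //.
by rewrite E; apply: cl_concat; rewrite -?E.
Qed.

Lemma cl_min Y T : tors lambda T -> Y `<=` T -> cl Y `<=` T.
Proof.
move=> [_ clT _] YT s; elim=> [{}s /YT//|a b _ ha _ hb]; exact: clT.
Qed.

Lemma cl_sub Y Y' : Y `<=` Y' -> cl Y `<=` cl Y'.
Proof.
move=> h s; elim=> [{}s /h|a b _ ha _ hb]; [exact: cl_base|exact: cl_concat].
Qed.

Definition quotients (X : set (seq vertex)) : set (seq vertex) :=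
  [set t | exists2 s, X s & part true s t].

Lemma quotients_closed X : X `<=` Seg lambda -> quotient_closed (quotients X).
Proof.
move=> sub; split=> [t [s /sub Hs Hst]|s t [r Xr Hrs] Hst].
  exact: segment_part Hst.
by exists r => //; apply: part_trans Hst.
Qed.

Lemma tors_gen X : X `<=` Seg lambda -> tors lambda (cl (quotients X)).
Proof. by move=> sub; apply/tors_cl/quotients_closed. Qed.

Lemma gen_mem X s : X `<=` Seg lambda -> X s -> cl (quotients X) s.
Proof.
by move=> sub Xs; apply: cl_base; exists s => //; apply/part_refl/(segment_neq0 (sub _ Xs)).
Qed.

Lemma gen_min X T : tors lambda T -> X `<=` T -> cl (quotients X) `<=` T.
Proof.
move=> HT XT; apply: cl_min => // t [s /XT Ts Hst].
by case: HT => _ _; apply; [exact: Ts|].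
Qed.

Definition union_tors (B : set (set (seq vertex))) : set (seq vertex) :=
  [set s | exists2 F, B F & Tof lambda F s].

Lemma union_tors_closed B : quotient_closed (union_tors B).
Proof.
split=> [s [F _ []] //|s t [F BF Fs] Hst].
exists F => //; have [_ _ qu] := tors_Tof lambda F; exact: qu Hst.
Qed.

Lemma is_joinP B x : B `<=` GT lambda ->
  is_join (GT lambda) (GT_le lambda) B x <->
  GT lambda x /\ Tof lambda x = cl (union_tors B).
Proof.
move=> BG; have HT := tors_cl (union_tors_closed B); have Gx := eta_GT (tors_biclosed HT).
have ET := Tof_eta HT; split=> [[Hx ub lub]|[Hx E]].
- split=> //; apply/seteqP; split.
    (* The closure itself gives an upper bound against which the join is tested. *)
    rewrite -ET; apply/GT_leP => //; apply: lub => // F BF.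
    apply/GT_leP; rewrite ?ET //; first exact: BG.
    by move=> s Fs; apply: cl_base; exists F.
  apply: cl_min; first exact: tors_Tof.
  by move=> s [F BF]; apply: ((GT_leP (BG _ BF) Hx).1 (ub _ BF)).
- split=> // [F BF|y Gy ub]; apply/GT_leP => //; rewrite ?E.
  + exact: BG.
  + by move=> s Fs; apply: cl_base; exists F.
  apply: cl_min; first exact: tors_Tof.
  by move=> s [F BF]; apply: ((GT_leP (BG _ BF) Gy).1 (ub _ BF)).
Qed.

Lemma fseg_GT s : segment s -> GT lambda (fseg lambda s).
Proof. by move=> Hs; apply/eta_GT/tors_biclosed/tors_SW. Qed.

Lemma Tof_fseg s t : segment s -> Tof lambda (fseg lambda s) t <-> part true s t.
Proof.
by move=> Hs; rewrite /fseg Tof_eta; [apply: SW_subsegmentsP|apply: tors_SW].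
Qed.

Lemma fseg_sub X : X `<=` Seg lambda -> fseg lambda @` X `<=` GT lambda.
Proof. by move=> sub _ [s /sub/fseg_GT ? <-]. Qed.

Lemma union_tors_fseg X : X `<=` Seg lambda -> union_tors (fseg lambda @` X) = quotients X.
Proof.
move=> sub; apply/seteqP; split=> t.
  by move=> [_ [s Xs <-] /(Tof_fseg _ (sub _ Xs)) h]; exists s.
move=> [s Xs h]; exists (fseg lambda s); first by exists s.
exact/(Tof_fseg _ (sub _ Xs)).
Qed.

Lemma fseg_le s F : segment s -> GT lambda F ->
  GT_le lambda (fseg lambda s) F <-> Tof lambda F s.
Proof.
move=> Hs HF; have sn := segment_neq0 Hs; split.
  move/(GT_leP (fseg_GT Hs) HF); apply; exact/Tof_fseg/part_refl.
move=> Fs; apply/GT_leP => //; first exact: fseg_GT.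
move=> t /(Tof_fseg _ Hs); have [_ _ qu] := tors_Tof lambda F; exact: qu.
Qed.

Lemma fseg_inj s t : segment s -> segment t -> fseg lambda s = fseg lambda t -> s = t.
Proof.
move=> Hs Ht E; apply: (@part_anti true).
  by apply/(Tof_fseg _ Hs); rewrite E; apply/(Tof_fseg _ Ht)/part_refl/(segment_neq0 Ht).
by apply/(Tof_fseg _ Ht); rewrite -E; apply/(Tof_fseg _ Hs)/part_refl/(segment_neq0 Hs).
Qed.

(* For string modules: a module filtered by members of Y has a submodule in Y. *)
Lemma cl_submodule Y t : quotient_closed Y -> cl Y t -> exists2 u, Y u & part false t u.
Proof.
move=> HY; have [sub _ _] := tors_cl HY.
elim=> [s Ys|a b /sub Ha [u Yu au] /sub Hb [w Yw bw] Hab].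
  by exists s => //; apply/part_refl/segment_neq0; case: HY => + _; apply.
have [an bn] := (segment_neq0 Ha, segment_neq0 Hb).
case E : (est a b).
  by exists w => //; apply: part_trans bw; apply: part_catr.
by exists u => //; apply: part_trans au; apply: part_catl.
Qed.

(** On each side of the unique occurrence of [u] the two mirrored conditions contradict each other,
    so both sides are empty. *)
Lemma part_both d s u : part d s u -> part (~~ d) s u -> sorted se_step s -> u = s.
Proof.
move=> [a [b [E un Ha Hb]]] [a' [b' [E' _ Ha' Hb']]] Hs.
have [Ea Eb] : a = a' /\ b = b'.
  by apply: (@occurrence_uniq _ a u b); rewrite -?E //; apply: se_sorted_uniq.
subst a' b'.
have a0 : a = [::].
  by apply: contrapT => /eqP an; have := Ha an; rewrite Ha' //; case: (d).
have b0 : b = [::].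
  by apply: contrapT => /eqP bn; have := Hb bn; rewrite Hb' //; case: (d).
by rewrite E a0 b0 cats0.
Qed.

(* The Schur lemma for semibricks: a nonzero morphism into s from a module
   filtered by quotients of members of X is surjective. *)
Lemma gen_schur X s t u : nonfriendly_complex lambda X -> X s ->
  cl (quotients X) t -> part true t u -> part false s u -> u = s.
Proof.
move=> [sub nf] Xs Ht; elim: Ht u => {t} [t [x Xx Hxt]|a b _ IHa _ IHb Hab] u tu su.
  have Hs := sub _ Xs; have Hx := sub _ Xx; have xu := part_trans Hxt tu.
  have [E|ne] := pselect (s = x).
    by subst x; apply: (part_both su xu (segment_sorted Hs)).
  have Hu := segment_part Hs su.
  case: (nf _ _ Xs Xx ne); exists u => //; apply/orP; left.
  by apply/(@friendly_orientedP lambda).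
case/part_cat_cases: tu => [/IHa/(_ su)|/IHb/(_ su)|[t1 [t2 [E h1 h2]]]] //.
have [n1 n2] := (part_neq0 h1, part_neq0 h2).
have szu : size u = (size t1 + size t2)%N by rewrite E size_cat.
have p1 := size_neq0 n1; have p2 := size_neq0 n2.
have us : (size u <= size s)%N by case: (part_size su) => [->|/ltnW].
(* The step at the cut makes [t1] or [t2] a NE-subsegment of [u], hence of [s]; by induction this
   proper piece of [u] would be all of [s]. *)
case Ec : (est t1 t2).
  have /(IHb _ h2) E2 : part false s t2.
    by apply: part_trans su _; rewrite E; apply: part_catr.
  by move: szu us; rewrite -E2; lia.
have /(IHa _ h1) E1 : part false s t1.
  by apply: part_trans su _; rewrite E; apply: part_catl.
by move: szu us; rewrite -E1; lia.
Qed.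

(** Some NE-subsegment [u] of [s] is in [Y], and [gen_schur] applied to [u] itself gives [u = s]. *)
Lemma mem_join_rep X s Y : nonfriendly_complex lambda X -> X s ->
  quotient_closed Y -> cl Y = cl (quotients X) -> Y s.
Proof.
move=> HX Xs HY E; have [sub _] := HX.
have [u Yu su] : exists2 u, Y u & part false s u.
  by apply: cl_submodule => //; rewrite E; apply: gen_mem.
rewrite -(gen_schur HX Xs (u := u) (t := u)) //.
  by rewrite -E; apply: cl_base.
exact/part_refl/(part_neq0 su).
Qed.

Lemma nonfriendly_canonical X : nonfriendly_complex lambda X ->
  canonical_join_rep (GT lambda) (GT_le lambda) (fseg lambda @` X)
    (eta lambda (cl (quotients X))).
Proof.
move=> HX; have [sub nf] := HX; set F := eta _ _.
have HT := tors_gen sub; have HF : GT lambda F by apply/eta_GT/tors_biclosed.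
have TF : Tof lambda F = cl (quotients X) by apply: Tof_eta.
have HA := fseg_sub sub.
(* Irredundance and minimality both come from here: each [s] in [X] already lies in the torsion
   class of some one member of [B]. *)
have key B s : B `<=` GT lambda -> is_join (GT lambda) (GT_le lambda) B F ->
    X s -> exists2 b, B b & Tof lambda b s.
  move=> BG /(is_joinP _ BG)[_ E] Xs.
  by apply: (mem_join_rep HX Xs (union_tors_closed B)); rewrite -E TF.
split; first split.
- by split=> //; apply/is_joinP => //; rewrite union_tors_fseg.
- move=> B [BA nAB]; have BG : B `<=` GT lambda by move=> b /BA/HA.
  have HB := tors_cl (union_tors_closed B); have Gy := eta_GT (tors_biclosed HB).
  have Jy : is_join (GT lambda) (GT_le lambda) B (eta lambda (cl (union_tors B))).
    by apply/is_joinP => //; rewrite Tof_eta.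
  exists (eta lambda (cl (union_tors B))); split=> //.
    apply/GT_leP => //; rewrite TF Tof_eta //; apply: cl_sub.
    by rewrite -union_tors_fseg // => t [b /BA Ab bt]; exists b.
  move=> yF; rewrite yF in Jy; apply: nAB => _ [s Xs <-].
  have [b Bb bs] := key _ _ BG Jy Xs.
  have [t Xt Eb] := BA _ Bb; subst b.
  have [->|ne] := pselect (s = t); first by [].
  have Hs := sub _ Xs; have Ht := sub _ Xt.
  (* As [s] is an SW-subsegment of [t], the two are friendly along [s] itself. *)
  case: (nf _ _ Xs Xt ne); exists s => //; apply/orP; left.
  apply/(@friendly_orientedP lambda) => //; split; first exact/part_refl/segment_neq0/Hs.
  exact/(Tof_fseg _ Ht).
- move=> B [[BG JB] _] _ [s Xs <-]; have [b Bb bs] := key _ _ BG JB Xs.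
  by exists b => //; apply/fseg_le => //; [apply: sub | apply: BG].
Qed.

(** Induction on the discarded set [C], which can gain segments only finitely often. *)
Lemma minimal_subset (P : set (seq vertex) -> Prop) Z0 : Z0 `<=` Seg lambda -> P Z0 ->
  exists Z, [/\ Z `<=` Z0, P Z & forall Z', Z' `<=` Z -> P Z' -> Z `<=` Z'].
Proof.
move=> sub P0.
suff H C : P (Z0 `\` C) -> exists Z, [/\ Z `<=` Z0, P Z & forall Z', Z' `<=` Z -> P Z' -> Z `<=` Z'].
  by apply: (H set0); rewrite setD0.
elim/(@segment_set_ind lambda): C => C IH PC.
have [Hmin|/existsNP[Z']] := pselect (forall Z', Z' `<=` Z0 `\` C -> P Z' -> Z0 `\` C `<=` Z').
  by exists (Z0 `\` C); split=> // z [].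
move=> /not_implyP[Z'sub /not_implyP[PZ' /existsNP[z /not_implyP[[Zz Cz] Z'z]]]].
apply: (IH (~` Z')).
- by move=> x Cx /Z'sub[].
- by exists z => //; apply: sub.
- rewrite setDE setCK (_ : Z0 `&` Z' = Z') //.
  by apply/seteqP; split=> [x []//|x Z'x]; split=> //; case: (Z'sub _ Z'x).
Qed.

(* If u is a submodule of s and a quotient of some t in X, then s may be
   replaced by the two pieces of s around u. *)
Lemma canonical_not_friendly X F s t u : X `<=` Seg lambda ->
  canonical_join_rep (GT lambda) (GT_le lambda) (fseg lambda @` X) F ->
  X s -> X t -> s <> t -> part false s u -> part true t u -> False.
Proof.
move=> sub [[[AG JF] irr] can] Xs Xt st su tu.
have [HF TF] := (is_joinP _ AG).1 JF; rewrite union_tors_fseg // in TF.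
have Hs := sub _ Xs; have [a [b [Es un Ha Hb]]] := su.
have sa : a != [::] -> part true s a.
  by move=> an; rewrite Es; apply: part_catl; rewrite ?cat_neq0l // est_catr // Ha.
have sb : b != [::] -> part true s b.
  move=> bn; rewrite Es catA; apply: part_catr; rewrite ?cat_neq0r // est_catl // Hb //.
(* The pieces [a] and [b] around the NE-subsegment [u] are SW-subsegments of [s], so trading [s] for
   them stays below [F]. *)
pose Z0 := (X `\ s) `|` [set z | (z = a \/ z = b) /\ z != [::]].
have Z0s z : Z0 z -> (X z /\ z <> s) \/ part true s z /\ (size z < size s)%N.
  have u0 := size_neq0 un.
  by move=> [[Xz zs]|[[->|->] zn]]; [left|right|right]; split=> //;
     [apply: sa| |apply: sb|]; rewrite // Es !size_cat; lia.
have Z0sub : Z0 `<=` Seg lambda.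
  by move=> z /Z0s[[/sub//]|[/(segment_part Hs)]].
have gen0 : cl (quotients Z0) = Tof lambda F.
  rewrite TF; apply/seteqP; split; apply: gen_min; try exact: tors_gen.
    have [_ _ qu] := tors_gen sub.
    by move=> z /Z0s[[Xz _]|[sz _]]; [apply: gen_mem | apply: (qu s) => //; apply: gen_mem].
  move=> z Xz; have [->|zs] := pselect (z = s); last by apply: gen_mem => //; left.
  (* [s] is rebuilt as [a ++ u ++ b], with [u] supplied by [t]. *)
  have Zu : cl (quotients Z0) u.
    by apply: cl_base; exists t => //; left; split=> //; apply: nesym.
  have Zub : cl (quotients Z0) (u ++ b).
    have [->|bn] := eqVneq b [::]; first by rewrite cats0.
    apply: cl_concat => //; first by apply: gen_mem => //; right; split=> //; right.
    by move: Hs; rewrite Es => /segment_catr; apply; apply: cat_neq0l.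
  rewrite Es; have [->//|an] := eqVneq a [::].
  by apply: cl_concat; rewrite -?Es //; apply: gen_mem => //; right; split=> //; left.
(* Canonicity compares with irredundant representations, so [Z0] is thinned out to a minimal
   generating set. *)
have [Z [ZZ0 genZ minZ]] := minimal_subset (P := fun Z => cl (quotients Z) = Tof lambda F) Z0sub gen0.
have subZ : Z `<=` Seg lambda by move=> z /ZZ0/Z0sub.
have BG := fseg_sub subZ.
have JB : irredundant_join_rep (GT lambda) (GT_le lambda) (fseg lambda @` Z) F.
  split; first by split=> //; apply/is_joinP => //; rewrite union_tors_fseg.
  move=> B [BZ nZB]; have BG' : B `<=` GT lambda by move=> y /BZ/BG.
  have HB := tors_cl (union_tors_closed B); have Gy := eta_GT (tors_biclosed HB).
  exists (eta lambda (cl (union_tors B))); split.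
  - by apply/is_joinP => //; rewrite Tof_eta.
  - apply/GT_leP => //; rewrite Tof_eta // -genZ; apply: cl_sub.
    by rewrite -union_tors_fseg // => y [G /BZ AG' Gy']; exists G.
  - move=> yF; apply: nZB => _ [z Zz <-].
    pose Z' := [set x | Z x /\ B (fseg lambda x)].
    have EB : B = fseg lambda @` Z'.
      apply/seteqP; split=> [G BG0|_ [x [_ Bx] <-] //].
      by have [x Zx Ex] := BZ _ BG0; exists x => //; split=> //; rewrite Ex.
    have Z'Z : Z' `<=` Z by move=> x [].
    have /(minZ _ Z'Z) : cl (quotients Z') = Tof lambda F.
      rewrite -union_tors_fseg -?EB; last by move=> x /Z'Z/subZ.
      by rewrite -yF Tof_eta.
    by move=> /(_ _ Zz)[].
(* Canonicity gives [z] in [Z] having [s] as an SW-subsegment. It is too long to be [a] or [b], so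
   it lies in [X] and differs from [s]. *)
have [_ [z Zz <-]] := can _ JB _ (ex_intro2 _ _ s Xs erefl).
have Hz := subZ _ Zz; move/(fseg_le Hs (fseg_GT Hz))/(Tof_fseg _ Hz) => zs.
case: (Z0s _ (ZZ0 _ Zz)) => [[Xz nzs]|[_ h]]; last first.
  by case: (part_size zs) h => [->|]; rewrite ?ltnn //; lia.
have sub1 : X `\ s `<=` Seg lambda by move=> x [/sub].
have [|y [Jy _ nyF]] := irr (fseg lambda @` (X `\ s)).
  split; first by move=> _ [x [Xx _] <-]; exists x.
  move/(_ _ (ex_intro2 _ _ s Xs erefl)) => [x [Xx xs] Ex].
  by apply: xs; apply: fseg_inj Ex => //; apply: sub.
have [Gy Ty] := (is_joinP _ (fseg_sub sub1)).1 Jy.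
apply: nyF; rewrite -(eta_Tof Gy) -(eta_Tof HF) Ty union_tors_fseg // TF; congr eta.
apply/seteqP; split; apply: gen_min; try exact: tors_gen.
  by move=> x [Xx _]; apply: gen_mem.
move=> x Xx; have [->|xs] := pselect (x = s); last by apply: gen_mem.
by apply: cl_base; exists z.
Qed.

End Lattice.

Theorem theorem4p9 (lambda : grid_shape) (X : set (seq vertex))
    (hX : X `<=` Seg lambda) :
  nonfriendly_complex lambda X <->
  exists F : set (seq vertex),
    GT lambda F /\
    canonical_join_rep (GT lambda) (GT_le lambda) (fseg lambda @` X) F.
Proof.
split=> [HX|[F [HF Hcan]]].
  exists (eta lambda (cl lambda (quotients X))); split; last exact: nonfriendly_canonical.
  by apply/eta_GT/tors_biclosed/tors_gen.
split=> // s t Xs Xt st [u Hu]; have [Hs Ht] := (hX _ Xs, hX _ Xt).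
case/orP => /(@friendly_orientedP lambda)[] // h1 h2.
  exact: canonical_not_friendly Hcan Xs Xt st h1 h2.
by apply: (canonical_not_friendly hX Hcan Xt Xs _ h1 h2); apply: nesym.
Qed.
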